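(* Let $d\ge2$, $s\in\mathbb N$, $\beta>-d-s$, and $\lambda_0,\dots,\lambda_{s-1}>0$. The polynomials $\mathsf S_{m,\ell}^{n,(\beta,-s)}$, $n\in\mathbb N_0$, $0\le m\le n$, $1\le\ell\le\dim\mathcal H_m^d$, are mutually orthogonal with respect to $\langle\cdot,\cdot\rangle_{\beta,-s}$, i.e. $\langle \mathsf S_{m,\ell}^{n,(\beta,-s)},\mathsf S_{m',\ell'}^{n',(\beta,-s)}\rangle_{\beta,-s}=0$ unless $(n,m,\ell)=(n',m',\ell')$; and for every $\ell$, $$\mathsf h_{m,n}^{(\beta,-s)}:=\langle \mathsf S_{m,\ell}^{n,(\beta,-s)},\mathsf S_{m,\ell}^{n,(\beta,-s)}\rangle_{\beta,-s}=\begin{cases}2^{2(n-m)}\lambda_{n-m},&0\le n-m\le s-1,\\[2pt] 2^{\,s-\beta-2m-d}\,\widehat h_{n-m-s}^{(s+2m+\beta+d-1,0)},& n-m\ge s.\end{cases}$$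
   Context: The conic surface is $\mathbb V_0^{d+1}=\{(x,t)\in\mathbb R^d\times\mathbb R:\|x\|=t,\ 0\le t\le1\}$; its points are written $(x,t)=(t\xi,t)$, $\xi\in\mathbb S^{d-1}$. $\mathrm d\mathsf m$ is its surface measure, with $\int_{\mathbb V_0^{d+1}}f\,\mathrm d\mathsf m=\int_0^1t^{d-1}\int_{\mathbb S^{d-1}}f(t\xi,t)\,\mathrm d\sigma(\xi)\,\mathrm dt$; $\sigma$ is surface measure on $\mathbb S^{d-1}$ and $\omega_d=2\pi^{d/2}/\Gamma(d/2)$. $\mathcal H_m^d$ is the space of spherical harmonics of degree $m$ on $\mathbb S^{d-1}$ and $\{Y_\ell^m:1\le\ell\le\dim\mathcal H_m^d\}$ an orthonormal basis for $\frac1{\omega_d}\int_{\mathbb S^{d-1}}fg\,\mathrm d\sigma$; $Y_\ell^m$ also denotes its extension to a homogeneous harmonic polynomial on $\mathbb R^d$ (so $Y_\ell^m(t\xi)=t^mY_\ell^m(\xi)$). Pochhammer $(a)_k=a(a+1)\cdots(a+k-1)$. Jacobi polynomials for real parameters: $P_n^{(\alpha,\beta)}(u)=\sum_{k=0}^n\frac{(\alpha+k+1)_{n-k}(-n)_k(n+\alpha+\beta+1)_k}{n!\,k!}(\frac{1-u}{2})^k$. $A_n^{(\alpha,\beta)}=2^n/(n+\alpha+\beta+1)_n$, $\widehat P_n^{(\alpha,\beta)}=A_n^{(\alpha,\beta)}P_n^{(\alpha,\beta)}$, and for $\alpha,\beta>-1$, $\widehat h_n^{(\alpha,\beta)}=\int_{-1}^1[\widehat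 P_n^{(\alpha,\beta)}(u)]^2(1-u)^\alpha(1+u)^\beta\,\mathrm du$. For $\alpha>-1-s$: $J_n^{(\alpha,-s)}(u)=\frac{(u+1)^n}{n!}$ if $0\le n\le s-1$, and $J_n^{(\alpha,-s)}(u)=\int_{-1}^u\frac{(u-w)^{s-1}}{(s-1)!}\widehat P_{n-s}^{(\alpha+s,0)}(w)\,\mathrm dw$ if $n\ge s$. Sobolev orthogonal polynomials: $\mathsf S_{m,\ell}^{n,(\beta,-s)}(x,t)=J_{n-m}^{(2m+\beta+d-1,-s)}(1-2t)\,Y_\ell^m(x)$, a polynomial in $(x,t)\in\mathbb R^{d+1}$. Sobolev inner product (for functions $f,g$ of $(x,t)\in\mathbb R^{d+1}$ for which it is finite, e.g. polynomials), with $\partial_t=\partial/\partial t$ the partial derivative in the last variable with $x$ held fixed: $\langle f,g\rangle_{\beta,-s}=\frac1{\omega_d}\int_{\mathbb V_0^{d+1}}\partial_t^sf(x,t)\,\partial_t^sg(x,t)\,t^{\beta+s}\,\mathrm d\mathsf m(x,t)+\sum_{k=0}^{s-1}\frac{\lambda_k}{\omega_d}\int_{\mathbb S^{d-1}}\partial_t^kf(\xi,1)\,\partial_t^kg(\xi,1)\,\mathrm d\sigma(\xi)$. *)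

(* Defs.v *)
From HB Require Import structures.
From mathcomp Require Import all_boot all_order all_algebra.
From mathcomp Require Import all_classical all_reals all_analysis.
From mathcomp Require mpoly.
Set Implicit Arguments. Unset Strict Implicit. Unset Printing Implicit Defensive.
Import Order.TTheory GRing.Theory Num.Theory.
Local Open Scope classical_set_scope.
Local Open Scope ring_scope.

Section Defs.
Variable R : realType.

Definition poch (a : R) (k : nat) : R := \prod_(i < k) (a + i%:R).

Definition jacobiP (al be : R) (n : nat) (u : R) : R :=
  \sum_(k < n.+1)
    (poch (al + k%:R + 1) (n - k) * poch (- n%:R) k * poch (n%:R + al + be + 1) k
      / (n`!%:R * k`!%:R)) * ((1 - u) / 2) ^+ k.

Definition jacA (al be : R) (n : nat) : R := 2 ^+ n / poch (n%:R + al + be + 1) n.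

Definition jacobiPhat (al be : R) (n : nat) (u : R) : R :=
  jacA al be n * jacobiP al be n u.

Definition jac_hhat (al be : R) (n : nat) : R :=
  Rintegral lebesgue_measure `[-1, 1]
    (fun u => (jacobiPhat al be n u) ^+ 2 * powR (1 - u) al * powR (1 + u) be).

Definition oint (a b : R) (f : R -> R) : R :=
  if a <= b then Rintegral lebesgue_measure `[a, b] f
  else - Rintegral lebesgue_measure `[b, a] f.

Definition jacJ (al : R) (s n : nat) (u : R) : R :=
  if (n < s)%N then (u + 1) ^+ n / n`!%:R
  else oint (-1) u (fun w => (u - w) ^+ s.-1 / (s.-1)`!%:R
                              * jacobiPhat (al + s%:R) 0 (n - s) w).

Definition enorm (d : nat) (x : 'rV[R]_d) : R := Num.sqrt (\sum_i x ord0 i ^+ 2).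

(* Lebesgue integral on R^n, defined as an iterated integral (Fubini) *)
Fixpoint iint (n : nat) (F : seq R -> R) : R :=
  match n with
  | 0%N => F [::]
  | n'.+1 => Rintegral lebesgue_measure setT (fun y => iint n' (fun s => F (y :: s)))
  end.

Definition lebint (d : nat) (g : 'rV[R]_d -> R) : R :=
  iint d (fun s => g (\row_i nth 0 s i)).

(* surface measure integral on S^{d-1}:  int_S g dsigma = d * int_{|x|<=1} g(x/|x|) dx *)
Definition sphere_int (d : nat) (g : 'rV[R]_d -> R) : R :=
  d%:R * lebint (fun x => (if enorm x <= 1 then 1 else 0) * g ((enorm x)^-1 *: x)).

(* Gamma(k/2) *)
Fixpoint gamma_half (k : nat) : R :=
  match k with
  | 0%N => 0 (* unused *)
  | 1%N => Num.sqrt pi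
  | 2%N => 1
  | (k'.+2) as k0 => (k'%:R / 2) * gamma_half k'
  end.

Definition omega (d : nat) : R := 2 * powR pi (d%:R / 2) / gamma_half d.

Definition cone_int (d : nat) (F : 'rV[R]_d -> R -> R) : R :=
  Rintegral lebesgue_measure `[0, 1]
    (fun t => t ^+ d.-1 * sphere_int (fun xi => F (t *: xi) t)).

Definition dtn (d k : nat) (f : 'rV[R]_d -> R -> R) (x : 'rV[R]_d) (t : R) : R :=
  derive1n k (f x) t.

Definition sob_ip (d : nat) (beta : R) (s : nat) (lam : nat -> R)
    (f g : 'rV[R]_d -> R -> R) : R :=
  (omega d)^-1 * cone_int (fun x t => dtn s f x t * dtn s g x t * powR t (beta + s%:R))
  + \sum_(k < s) lam k / omega d * sphere_int (fun xi => dtn k f xi 1 * dtn k g xi 1).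

Definition peval (d : nat) (p : mpoly.mpoly d R) (x : 'rV[R]_d) : R :=
  mpoly.meval (fun i => x ord0 i) p.

Definition homog_harmonic (d m : nat) (p : mpoly.mpoly d R) : Prop :=
  all (fun mon : mpoly.multinom d => mpoly.mdeg mon == m) (mpoly.msupp p) /\
  \sum_(i < d) mpoly.mderiv i (mpoly.mderiv i p) = 0.

Definition on_sphere (d : nat) (x : 'rV[R]_d) : Prop := enorm x = 1.

Definition sph_harm_ONB (d : nat) (N : nat -> nat) (Y : nat -> nat -> mpoly.mpoly d R) : Prop :=
  forall m : nat,
    (forall l, (1 <= l <= N m)%N -> homog_harmonic m (Y m l)) /\
    (forall l l', (1 <= l <= N m)%N -> (1 <= l' <= N m)%N ->
       (omega d)^-1 * sphere_int (fun xi => peval (Y m l) xi * peval (Y m l') xi)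
       = (l == l')%:R) /\
    (forall p, homog_harmonic m p ->
       exists c : nat -> R, forall xi, on_sphere xi ->
         peval p xi = \sum_(1 <= l < (N m).+1) c l * peval (Y m l) xi).

Definition sobS (d : nat) (Y : nat -> nat -> mpoly.mpoly d R) (beta : R) (s n m l : nat)
    : 'rV[R]_d -> R -> R :=
  fun x t => jacJ (2 * m%:R + beta + d%:R - 1) s (n - m) (1 - 2 * t) * peval (Y m l) x.

Definition sob_h (d : nat) (beta : R) (s : nat) (lam : nat -> R) (m n : nat) : R :=
  if (n - m < s)%N then 2 ^+ (2 * (n - m)) * lam (n - m)%N
  else powR 2 (s%:R - beta - 2 * m%:R - d%:R)
       * jac_hhat (s%:R + 2 * m%:R + beta + d%:R - 1) 0 (n - m - s).

End Defs.

(* Main.v *)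
(* Homogeneity of the harmonics separates the variables: every term of the inner
   product of two polynomials q(1 - 2t) Y(x) is a radial factor times the integral
   of Y Y' over the sphere.

   Spherical part. Slicing the unit ball reduces its moments to one-dimensional
   Beta integrals, whose recursions give I(d_i f) = (k + d + 1) I(x_i f) for f
   homogeneous of degree k, where I is the integral over the ball. For homogeneous
   harmonic p, q of degrees k, l this yields
     sum_i I(d_i p d_i q) = (k + l + d) l I(pq) = (k + l + d) k I(pq),
   so I(pq) = 0 if k <> l, and a layer-cake argument identifies the integral of pq
   over the sphere with (k + l + d) I(pq).

   Radial part. J_n is the s-fold primitive from -1 of P-hat_{n-s} (resp. the Taylor
   monomial (u+1)^n/n! if n < s), so the boundary terms only see n - m < s and the
   integral over the cone only sees n - m >= s, where it reduces to the orthogonality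
   of the Jacobi polynomials for the weight t^al on [0, 1]. The latter holds because
   the n-th finite difference kills polynomials of degree < n. *)

Require Import Defs.
From HB Require Import structures.
From mathcomp Require Import all_boot all_order all_algebra.
From mathcomp Require Import all_classical all_reals all_analysis.
From mathcomp Require Import measurable_realfun.
From mathcomp Require mpoly.
From mathcomp Require Import ring lra zify.
Import -(notations) mpoly.
Import Order.TTheory GRing.Theory Num.Theory.
Import numFieldNormedType.Exports.
Local Open Scope classical_set_scope.
Local Open Scope ring_scope.

Set Implicit Arguments. Unset Strict Implicit. Unset Printing Implicit Defensive.

Section affine_change_of_variable.
Context {R : realType}.
Implicit Types (a b : R) (A D : set R).
Local Notation mu := (@lebesgue_measure R).

Lemma measurable_affine a b : measurable_fun [set: R] (fun x => a * x + b).
Proof. by apply: measurable_funD => //; exact: measurable_funM. Qed.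

Lemma preimage_affine_itvoc a b (l r : R) : a != 0 ->
  (fun x => a * x + b) @^-1` `]l, r] =
  if 0 < a then `](l - b) / a, (r - b) / a]%classic
  else `[(r - b) / a, (l - b) / a[%classic.
Proof.
move=> a0; apply/seteqP; case: (ltP 0 a) => sa; split => x /=; rewrite !in_itv/=.
- by rewrite ltr_pdivrMr // ler_pdivlMr // ltrBlDr lerBrDr mulrC.
- by rewrite ltr_pdivrMr // ler_pdivlMr // ltrBlDr lerBrDr mulrC.
- have an : a < 0 by rewrite lt_neqAle a0.
  by rewrite ltr_ndivlMr // ler_ndivrMr // ltrBlDr lerBrDr mulrC andbC.
- have an : a < 0 by rewrite lt_neqAle a0.
  by rewrite ltr_ndivlMr // ler_ndivrMr // ltrBlDr lerBrDr mulrC andbC.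
Qed.

Lemma lebesgue_measure_affine a b A : a != 0 -> measurable A ->
  mu A = (`|a|%:E * pushforward mu (fun x : measurableTypeR R =>
    a * x + b : measurableTypeR R)%R A)%E.
Proof.
move=> a0 mA; pose f (x : measurableTypeR R) : measurableTypeR R := a * x + b.
have na0 : 0 <= `|a| by [].
pose nu : {measure set (measurableTypeR R) -> \bar R} :=
  mscale (NngNum na0) (pushforward mu f).
rewrite -[RHS]/(nu (measurable_affine a b) A).
apply: (@lebesgue_measure_unique _ (nu _)) => // _ [[l r]] _ <-.
rewrite -[nu _ _]/(`|a|%:E * mu (f @^-1` `]l, r]))%E preimage_affine_itvoc//.
rewrite lebesgue_measure_itv/= lte_fin.
case: (ltP 0 a) => sa; rewrite lebesgue_measure_itv/= lte_fin.
  rewrite ltr_pM2r ?invr_gt0// ltrD2r; case: ifP => _; last by rewrite mule0.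
  by rewrite -!EFinD -EFinM gtr0_norm//; congr EFin; field.
have an : a < 0 by rewrite lt_neqAle a0.
rewrite ltr_nM2r ?invr_lt0// ltrD2r; case: ifP => _; last by rewrite mule0.
by rewrite -!EFinD -EFinM ltr0_norm//; congr EFin; field.
Qed.

Lemma ge0_integral_affine a b (f : R -> \bar R) D : a != 0 ->
  measurable D -> measurable_fun D f -> (forall x, D x -> 0 <= f x)%E ->
  (\int[mu]_(x in D) f x =
   `|a|%:E * \int[mu]_(x in (fun x => a * x + b)%R @^-1` D) f (a * x + b)%R)%E.
Proof.
move=> a0 mD mf f0; pose g (x : measurableTypeR R) : measurableTypeR R := a * x + b.
have na0 : 0 <= `|a| by [].
pose nu : {measure set (measurableTypeR R) -> \bar R} :=
  mscale (NngNum na0) (pushforward mu g).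
rewrite (eq_measure_integral (nu (measurable_affine a b))); last first.
  by move=> A mA _; exact: lebesgue_measure_affine.
rewrite ge0_integral_mscale//= ge0_integral_pushforward//.
  exact: measurable_affine.
by move=> y; rewrite inE; exact: f0.
Qed.

Lemma Rintegral_affine a b (f : R -> R) D : a != 0 ->
  measurable D -> measurable_fun D f ->
  \int[mu]_(x in D) f x =
  `|a| * \int[mu]_(x in (fun x => a * x + b) @^-1` D) f (a * x + b).
Proof.
move=> a0 mD mf; have na : (0 < `|a|%:E :> \bar R)%E by rewrite lte_fin normr_gt0.
have mEf : measurable_fun D (EFin \o f) by exact/measurable_EFinP.
rewrite /Rintegral integralE [in RHS]integralE.
rewrite (ge0_integral_affine b a0 mD (measurable_funepos mEf))//.
rewrite (ge0_integral_affine b a0 mD (measurable_funeneg mEf))//.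
have -> : (fun x => (EFin \o f)^\+ (a * x + b)%R)%E =
    ((fun x => (f (a * x + b)%R)%:E)^\+)%E.
  by apply/funext => x; rewrite !funeposE.
have -> : (fun x => (EFin \o f)^\- (a * x + b)%R)%E =
    ((fun x => (f (a * x + b)%R)%:E)^\-)%E.
  by apply/funext => x; rewrite !funenegE.
set P := integral _ _ _; set N := integral _ _ _.
have : (0 <= P)%E by exact: integral_ge0.
have : (0 <= N)%E by exact: integral_ge0.
case: P N => [p| |] [n| |] //= _ _; rewrite ?gt0_muley//= ?mulr0//.
by rewrite mulrBr.
Qed.

Lemma Rintegral_scale a (f : R -> R) : a != 0 -> measurable_fun [set: R] f ->
  \int[mu]_x f x = `|a| * \int[mu]_x f (a * x).
Proof.
move=> a0 mf; rewrite (Rintegral_affine 0 a0)// preimage_setT.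
by congr (_ * _); apply: eq_Rintegral => x _; rewrite addr0.
Qed.

End affine_change_of_variable.

Section polynomial_integral.
Context {R : realType}.
Local Notation mu := (@lebesgue_measure R).
Implicit Types (p : {poly R}) (a b : R).

Lemma measurable_horner p : measurable_fun [set: R] (horner p).
Proof. by apply: continuous_measurable_fun; exact: continuous_horner. Qed.

Lemma integrable_horner p a b : mu.-integrable `[a, b] (EFin \o horner p).
Proof.
apply: continuous_compact_integrable; first exact: segment_compact.
by apply: continuous_subspaceT; exact: continuous_horner.
Qed.

Lemma Rintegral_deriv_horner p a b : a <= b ->
  \int[mu]_(x in `[a, b]) p^`().[x] = p.[b] - p.[a].
Proof.
rewrite le_eqVlt => /predU1P[<-|ab]; first by rewrite set_itv1 Rintegral_set1 subrr.
rewrite /Rintegral (@continuous_FTC2 _ (horner p^`()) (horner p))//.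
- by apply: continuous_subspaceT; exact: continuous_horner.
- split.
  + by move=> x _; exact: derivable_horner.
  + by apply: cvg_at_right_filter; exact: continuous_horner.
  + by apply: cvg_at_left_filter; exact: continuous_horner.
- by move=> x _; rewrite derivE.
Qed.

Lemma Rintegral_deriv_horner_itvoc (p : {poly R}) :
  \int[mu]_(r in `]0, 1]) p^`().[r] = p.[1] - p.[0].
Proof.
rewrite Rintegral_itv_obnd_cbnd ?Rintegral_deriv_horner//.
apply: (integrableS _ _ _ (integrable_horner _ 0 1)) => //.
exact: subset_itv_oc_cc.
Qed.

End polynomial_integral.

Lemma Rintegral0_eq d (T : measurableType d) (R : realType)
    (nu : {measure set T -> \bar R}) (A : set T) (f : T -> R) :
  (forall x, A x -> f x = 0) -> \int[nu]_(x in A) f x = 0.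
Proof. by move=> f0; rewrite /Rintegral integral0_eq// => x Ax; rewrite f0. Qed.

Lemma Rintegral_indicM d (T : measurableType d) (R : realType)
    (nu : {measure set T -> \bar R}) (A : set T) (f : T -> R) :
  \int[nu]_x (\1_A x * f x) = \int[nu]_(x in A) f x.
Proof.
by rewrite [RHS]Rintegral_mkcond patch_indic; apply: eq_Rintegral => x _; rewrite mulrC.
Qed.

Section bounded_support.
Context d (T : measurableType d) {R : realType} (mu : {measure set T -> \bar R}).
Variables (A : set T) (K : R) (f : T -> R).
Hypotheses (mA : measurable A) (Aoo : (mu A < +oo)%E).
Hypotheses (mf : measurable_fun [set: T] f).
Hypothesis fA : forall x, `|f x| <= K * \1_A x.

Let integrable_indicA : mu.-integrable [set: T] (EFin \o \1_A).
Proof.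
apply/integrableP; split; first exact/measurable_EFinP.
rewrite (eq_integral (fun x => (\1_A x)%:E)) => [|x _]; last by rewrite /= ger0_norm.
by rewrite integral_indic// setIT.
Qed.

Let integrable_bound : mu.-integrable [set: T] (EFin \o (fun x => K * \1_A x)).
Proof. exact: (integrableZl measurableT K integrable_indicA). Qed.

Lemma integrable_bounded_support : mu.-integrable [set: T] (EFin \o f).
Proof.
apply: le_integrable integrable_bound => //; first exact/measurable_EFinP.
by move=> x _; rewrite /= lee_fin (le_trans (fA x))// ler_norm.
Qed.

Lemma le_normr_Rintegral_support : `|\int[mu]_x f x| <= K * fine (mu A).
Proof.
apply: (le_trans (le_normr_Rintegral measurableT integrable_bounded_support)).
have <- : \int[mu]_x (K * \1_A x) = K * fine (mu A).
  by rewrite RintegralZl//; congr (_ * fine _); rewrite integral_indic// setIT.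
by apply: le_Rintegral => //; exact: integrable_abse integrable_bounded_support.
Qed.

End bounded_support.

Section Rintegral_product.
Context {R : realType}.
Local Open Scope ereal_scope.

Lemma measurable_fun_Rintegral d1 d2 (T1 : measurableType d1) (T2 : measurableType d2)
    (m2 : {sigma_finite_measure set T2 -> \bar R}) (f : T1 * T2 -> R) :
  measurable_fun [set: T1 * T2] f ->
  measurable_fun [set: T1] (fun x => \int[m2]_y f (x, y))%R.
Proof.
move=> /measurable_EFinP mf.
have -> : (fun x => \int[m2]_y f (x, y))%R =
    fine \o (fubini_F m2 (EFin \o f)^\+ \- fubini_F m2 (EFin \o f)^\-).
  apply/funext => x; rewrite /= /Rintegral integralE /fubini_F; congr (fine (_ - _)).
    by apply: eq_integral => y _; rewrite !funeposE.
  by apply: eq_integral => y _; rewrite !funenegE.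
apply: measurableT_comp; first exact: fine_measurable.
apply: emeasurable_funB; apply: measurable_fun_fubini_tonelli_F => //.
- exact: measurable_funepos.
- exact: measurable_funeneg.
Qed.

Lemma Rintegral_Fubini d1 d2 (T1 : measurableType d1) (T2 : measurableType d2)
    (m1 : {sigma_finite_measure set T1 -> \bar R})
    (m2 : {sigma_finite_measure set T2 -> \bar R}) (f : T1 * T2 -> R) :
  (m1 \x m2).-integrable [set: T1 * T2] (EFin \o f) ->
  (\int[m1]_x \int[m2]_y f (x, y) = \int[m2]_y \int[m1]_x f (x, y))%R.
Proof.
move=> intf; have /measurable_EFinP mf := measurable_int _ intf.
rewrite /Rintegral; congr fine.
transitivity (\int[m1]_x \int[m2]_y (f (x, y))%:E).
  apply: ae_eq_integral => //.
  - exact/measurable_EFinP/measurable_fun_Rintegral.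
  - exact: measurable_fubini_F intf.
  - apply: filterS (ae_integrable1 intf) => x intfx _ /=.
    by rewrite fineK//; exact: integrable_fin_num.
rewrite (Fubini intf); apply: ae_eq_integral => //.
- exact: measurable_fubini_G intf.
- apply/measurable_EFinP.
  apply: (@measurable_fun_Rintegral _ _ _ _ m1 (f \o unstable.swap)).
  by apply: measurableT_comp mf _; exact: measurable_swap.
- apply: filterS (ae_integrable2 intf) => y intfy _ /=.
  by rewrite fineK//; exact: integrable_fin_num.
Qed.

End Rintegral_product.

Section iterated_integral.
Context {R : realType}.
Local Notation mu := (@lebesgue_measure R).
Implicit Types (F G : seq R -> R) (c y : R).

Definition cube_indic (s : seq R) : R := \prod_(x <- s) \1_`[-1, 1]%classic x.

Definition cube_bounded n F (M : R) := forall s : n.-tuple R, `|F s| <= M * cube_indic s.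

Definition cube_integrand n F :=
  measurable_fun [set: n.-tuple R] (fun s : n.-tuple R => F s) /\
  exists M, cube_bounded n F M.

Lemma mem_itv11 y : (y \in `[-1, 1]%classic) = (`|y| <= 1).
Proof. by rewrite mem_setE in_itv/= -ler_norml. Qed.

Lemma cube_indic_cons y s : cube_indic (y :: s) = \1_`[-1, 1]%classic y * cube_indic s.
Proof. exact: big_cons. Qed.

Lemma cube_indic_ge0 s : 0 <= cube_indic s.
Proof. exact: prodr_ge0. Qed.

Lemma cube_indic1 s : (forall x, x \in s -> `|x| <= 1) -> cube_indic s = 1.
Proof.
move=> s1; rewrite /cube_indic big_seq big1// => x /s1 x1.
by rewrite indicE mem_itv11 x1.
Qed.

Lemma measurable_cons_tuple n y :
  measurable_fun [set: n.-tuple R] (fun s : n.-tuple R => [tuple of y :: s]).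
Proof. exact: measurable_cons. Qed.

Lemma eq_iint n F G : (forall s, size s = n -> F s = G s) -> iint n F = iint n G.
Proof.
elim: n F G => [|n IH] F G FG /=; first exact: FG.
by congr Rintegral; apply/funext => y; apply: IH => s sn; apply: FG; rewrite /= sn.
Qed.

Lemma iint0 n : iint n (fun=> 0 : R) = 0.
Proof.
by elim: n => [//|n IH] /=; apply: Rintegral0_eq => y _.
Qed.

Lemma measurable_fun_uncons n d (T : measurableType d) (F : T -> seq R -> R) :
  measurable_fun [set: T * n.+1.-tuple R] (fun p : T * n.+1.-tuple R => F p.1 p.2) ->
  measurable_fun [set: T * R * n.-tuple R]
    (fun q : T * R * n.-tuple R => F q.1.1 (q.1.2 :: q.2)).
Proof.
move=> mF; apply: (measurableT_comp mF
  (g := fun q : T * R * n.-tuple R => (q.1.1, [tuple of q.1.2 :: q.2]))).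
apply: measurable_fun_pair; first exact: measurableT_comp.
by apply: measurable_cons => //; exact: measurableT_comp.
Qed.

(* Generalizing over the parameter space lets the induction move the entries of
   the sequence into it one by one. *)
Lemma measurable_iint n d (T : measurableType d) (F : T -> seq R -> R) :
  measurable_fun [set: T * n.-tuple R] (fun p : T * n.-tuple R => F p.1 p.2) ->
  measurable_fun [set: T] (fun t => iint n (F t)).
Proof.
elim: n d T F => [|n IH] d T F mF /=.
  exact: (measurableT_comp mF (pair2_measurable _)).
apply: (@measurable_fun_Rintegral _ _ _ _ _ mu (fun p => iint n (fun s => F p.1 (p.2 :: s)))).
by apply: (IH _ _ (fun p s => F p.1 (p.2 :: s))); exact: measurable_fun_uncons.
Qed.

Lemma cube_bounded_cons n F M y : cube_bounded n.+1 F M ->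
  cube_bounded n (fun s => F (y :: s)) (M * \1_`[-1, 1]%classic y).
Proof. by move=> FM s; rewrite -mulrA -cube_indic_cons; exact: (FM [tuple of y :: s]). Qed.

Lemma cube_integrand_cons n F y : cube_integrand n.+1 F ->
  cube_integrand n (fun s => F (y :: s)).
Proof.
move=> [mF [M FM]]; split; first exact: measurableT_comp mF (measurable_cons_tuple y).
by exists (M * \1_`[-1, 1]%classic y); exact: cube_bounded_cons.
Qed.

Lemma measurable_iint_cons n F : cube_integrand n.+1 F ->
  measurable_fun [set: R] (fun y => iint n (fun s => F (y :: s))).
Proof.
move=> [mF _]; apply: (measurable_iint (F := fun y s => F (y :: s))).
apply: (measurableT_comp mF (g := fun p : R * n.-tuple R => [tuple of p.1 :: p.2])).
exact: measurable_cons.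
Qed.

Lemma lebesgue_measure_itv11 : mu `[-1, 1]%classic = 2%:E.
Proof. by rewrite lebesgue_measure_itv/= lte_fin gtrN// -EFinB opprK. Qed.

Lemma lebesgue_measure_itv_lty (a b : R) (b0 b1 : bool) :
  (mu [set` Interval (BSide b0 a) (BSide b1 b)] < +oo)%E.
Proof. by rewrite lebesgue_measure_itv/=; case: ifP => _; rewrite ltry. Qed.

Lemma normr_iint_le n F M : cube_integrand n F -> cube_bounded n F M ->
  `|iint n F| <= M * 2 ^+ n.
Proof.
elim: n F M => [|n IH] F M iF FM /=.
  by have := FM [tuple]; rewrite /cube_indic big_nil expr0.
rewrite exprSr mulrA -[X in _ * X]/(fine 2%:E) -lebesgue_measure_itv11.
apply: le_normr_Rintegral_support => //; first exact: lebesgue_measure_itv_lty.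
  exact: measurable_iint_cons.
by move=> y; rewrite mulrAC; apply: IH (cube_bounded_cons _ FM); exact: cube_integrand_cons.
Qed.

Lemma integrable_iint_cons n F : cube_integrand n.+1 F ->
  mu.-integrable [set: R] (EFin \o (fun y => iint n (fun s => F (y :: s)))).
Proof.
move=> iF; have [_ [M FM]] := iF.
apply: (@integrable_bounded_support _ _ _ mu `[-1, 1]%classic (M * 2 ^+ n)) => //.
- exact: lebesgue_measure_itv_lty.
- exact: measurable_iint_cons.
- move=> y; rewrite mulrAC; apply: normr_iint_le; last exact: cube_bounded_cons.
  exact: cube_integrand_cons.
Qed.

Lemma iintD n F G : cube_integrand n F -> cube_integrand n G ->
  iint n (fun s => F s + G s) = iint n F + iint n G.
Proof.
elim: n F G => [|n IH] F G iF iG //=; rewrite -RintegralD//; try exact: integrable_iint_cons.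
by apply: eq_Rintegral => y _; apply: IH; exact: cube_integrand_cons.
Qed.

Lemma iintZ n c F : cube_integrand n F -> iint n (fun s => c * F s) = c * iint n F.
Proof.
elim: n F => [|n IH] F iF //=; rewrite -RintegralZl//; last exact: integrable_iint_cons.
by apply: eq_Rintegral => y _; apply: IH; exact: cube_integrand_cons.
Qed.

Lemma iint_scale n c F : c != 0 -> cube_integrand n F ->
  iint n (fun s => F [seq c * x | x <- s]) = `|c| ^- n * iint n F.
Proof.
move=> c0; elim: n F => [|n IH] F iF /=; first by rewrite invr1 mul1r.
pose g y := `|c| ^- n * iint n (fun s => F (y :: s)).
transitivity (\int[mu]_y g (c * y)).
  by apply: eq_Rintegral => y _; rewrite /g -IH//; exact: cube_integrand_cons.
have mg : measurable_fun [set: R] g.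
  by apply: measurable_funM => //; exact: measurable_iint_cons.
apply: (mulfI (x := `|c|)); first by rewrite normr_eq0.
rewrite -[LHS]Rintegral_scale// RintegralZl//; last exact: integrable_iint_cons.
by rewrite exprS invfM mulrA mulrA divff ?mul1r ?normr_eq0.
Qed.

Lemma Rintegral_iint n d (T : measurableType d)
    (nu : {sigma_finite_measure set T -> \bar R}) (D : set T) (M : R)
    (F : T -> seq R -> R) : measurable D -> (nu D < +oo)%E ->
  measurable_fun [set: T * n.-tuple R] (fun p : T * n.-tuple R => F p.1 p.2) ->
  (forall t, cube_bounded n (F t) (M * \1_D t)) ->
  \int[nu]_t iint n (F t) = iint n (fun s => \int[nu]_t F t s).
Proof.
move=> mD Doo; elim: n F M => [//|n IH] F M mF FM /=.
have mF_cons := measurable_fun_uncons mF.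
have mK : measurable (`[-1, 1]%classic : set R) by [].
pose K : set R := `[-1, 1]%classic.
rewrite (@Rintegral_Fubini _ _ _ _ _ nu mu (fun p => iint n (fun s => F p.1 (p.2 :: s)))).
  apply: eq_Rintegral => y _; apply: (IH _ (M * \1_K y)).
    apply: (measurableT_comp mF_cons (g := fun p : T * n.-tuple R => (p.1, y, p.2))).
    by apply: measurable_fun_pair => //; apply: measurable_fun_pair.
  by move=> t; rewrite mulrAC; exact: cube_bounded_cons.
apply: (@integrable_bounded_support _ _ _ (nu \x mu)%E (D `*` K) (M * 2 ^+ n)).
- exact: (measurableX mD mK).
- rewrite -[X in (X < _)%E]/((nu \x mu)%E (D `*` K)) (product_measure1E nu mu mD mK).
  by rewrite lte_mul_pinfty ?ge0_fin_numE//; exact: lebesgue_measure_itv_lty.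
- exact: (measurable_iint (F := fun p s => F p.1 (p.2 :: s))).
- move=> [t y]; have bF := cube_bounded_cons y (FM t).
  have -> : \1_(D `*` K) (t, y) = \1_D t * \1_K y :> R.
    by rewrite !indicE -natrM mulnb in_setX.
  rewrite mulrA [M * _ * _]mulrAC [_ * 2 ^+ n * _]mulrAC; apply: normr_iint_le (bF).
  split; last by exists (M * \1_D t * \1_K y).
  apply: (measurableT_comp mF_cons (g := fun s : n.-tuple R => (t, y, s))).
  exact: pair1_measurable.
Qed.

End iterated_integral.

Section slice_moments.
Context {R : realType}.
Local Notation mu := (@lebesgue_measure R).
Implicit Types (y rho c : R) (k e : nat).

(* [rho ^ (e/2)] on the half-line [0 <= rho] and [0] outside: for [e = 0] this is
   the indicator of the half-line, and the family is stable, up to constants,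
   under integration over the slices of a ball. *)
Definition halfpow rho e : R := if 0 <= rho then Num.sqrt rho ^+ e else 0.

Definition slice_moment k e : R := \int[mu]_y (y ^+ k * halfpow (1 - y ^+ 2) e).

Lemma halfpow_lt0 rho e : rho < 0 -> halfpow rho e = 0.
Proof. by rewrite /halfpow ltNge => /negbTE ->. Qed.

Lemma halfpowM c rho e : 0 < c -> halfpow (c ^+ 2 * rho) e = c ^+ e * halfpow rho e.
Proof.
move=> c0; rewrite /halfpow pmulr_rge0 ?exprn_gt0//; case: ifPn => _; last by rewrite mulr0.
by rewrite sqrtrM ?sqr_ge0// sqrtr_sqr gtr0_norm// exprMn.
Qed.

Lemma measurable_sqrt : measurable_fun [set: R] (@Num.sqrt R).
Proof. by apply: continuous_measurable_fun; exact: sqrt_continuous. Qed.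

Lemma measurable_halfpow e : measurable_fun [set: R] (halfpow ^~ e).
Proof.
apply: measurable_fun_ifT => //; first exact: measurable_fun_ler.
by apply: measurable_funX; exact: measurable_sqrt.
Qed.

Lemma measurable_slice rho k e :
  measurable_fun [set: R] (fun y => y ^+ k * halfpow (rho - y ^+ 2) e).
Proof.
apply: measurable_funM; first exact: exprn_measurable.
apply: (measurableT_comp (measurable_halfpow e) (g := fun y => rho - y ^+ 2)).
by apply: measurable_funB => //; exact: exprn_measurable.
Qed.

Lemma normr_slice_le rho k e y : rho <= 1 ->
  `|y ^+ k * halfpow (rho - y ^+ 2) e| <= 1 * \1_`[-1, 1]%classic y.
Proof.
move=> rho1; rewrite mul1r indicE mem_itv11 /halfpow subr_ge0; case: ifPn => yrho; last first.
  by rewrite mulr0 normr0 ler0n.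
have y1 : `|y| <= 1 by rewrite -(@expr_le1 _ 2)// real_normK ?num_real// (le_trans yrho).
rewrite y1 normrM normrX mulr_ile1// ?exprn_ile1// normrX exprn_ile1//.
rewrite ger0_norm ?sqrtr_ge0// -[leRHS]sqrtr1 ler_wsqrtr// (le_trans _ rho1)//.
by rewrite gerBl sqr_ge0.
Qed.

Lemma integrable_slice rho k e : rho <= 1 ->
  mu.-integrable [set: R] (EFin \o (fun y => y ^+ k * halfpow (rho - y ^+ 2) e)).
Proof.
move=> rho1; apply: (@integrable_bounded_support _ _ _ mu `[-1, 1]%classic 1) => //.
- exact: lebesgue_measure_itv_lty.
- exact: measurable_slice.
- by move=> y; exact: normr_slice_le.
Qed.

Lemma Rintegral_slice0 k e : \int[mu]_y (y ^+ k * halfpow (0 - y ^+ 2) e) = 0.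
Proof.
rewrite -[RHS](Rintegral_set1 (fun y : R => y ^+ k * halfpow (0 - y ^+ 2) e) 0).
rewrite [RHS]Rintegral_mkcond; apply: eq_Rintegral => y _; rewrite patchE.
case: (boolP (y \in [set 0])) => //; rewrite notin_setE/= => y0.
by rewrite halfpow_lt0 ?mulr0// sub0r oppr_lt0 exprn_even_gt0//=; exact/eqP.
Qed.

Lemma Rintegral_slice k e rho :
  \int[mu]_y (y ^+ k * halfpow (rho - y ^+ 2) e) = slice_moment k e * halfpow rho (k + e).+1.
Proof.
case: (ltrgtP rho 0) => [rho0|rho0|->]; last first.
- by rewrite Rintegral_slice0 /halfpow lexx sqrtr0 expr0n mulr0.
- pose c := Num.sqrt rho; have c0 : 0 < c by rewrite sqrtr_gt0.
  rewrite (Rintegral_scale (lt0r_neq0 c0)) ?gtr0_norm//; last exact: measurable_slice.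
  transitivity (c * \int[mu]_y (c ^+ (k + e) * (y ^+ k * halfpow (1 - y ^+ 2) e))).
    congr (_ * _); apply: eq_Rintegral => y _.
    have -> : rho - (c * y) ^+ 2 = c ^+ 2 * (1 - y ^+ 2).
      by rewrite exprMn mulrBr mulr1 sqr_sqrtr// ltW.
    by rewrite halfpowM// exprMn exprD mulrACA.
  rewrite RintegralZl//; last exact: integrable_slice.
  by rewrite mulrA -exprS mulrC /halfpow ltW.
- rewrite (halfpow_lt0 _ rho0) mulr0; apply: Rintegral0_eq => y _.
  by rewrite halfpow_lt0 ?mulr0// subr_lt0 (lt_le_trans rho0)// sqr_ge0.
Qed.

Lemma slice_moment_itv k e :
  slice_moment k e = \int[mu]_(y in `[-1, 1]) (y ^+ k * Num.sqrt (1 - y ^+ 2) ^+ e).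
Proof.
rewrite [RHS]Rintegral_mkcond; apply: eq_Rintegral => y _; rewrite patchE /halfpow.
have -> : (0 <= 1 - y ^+ 2) = (y \in `[-1, 1]%classic).
  by rewrite mem_itv11 subr_ge0 -real_normK ?num_real// expr_le1.
by case: ifP => _; rewrite ?mulr0.
Qed.

Lemma continuous_sqrt1BX2 k e : continuous (fun y : R => y ^+ k * Num.sqrt (1 - y ^+ 2) ^+ e).
Proof.
have c1 : continuous (fun y : R => Num.sqrt (1 - y ^+ 2)).
  move=> y; apply: (@continuous_comp _ _ _ (fun y : R => 1 - y ^+ 2)).
    by apply: cvgB; [exact: cvg_cst|exact: exprn_continuous].
  exact: sqrt_continuous.
move=> y; apply: cvgM; first exact: exprn_continuous.
apply: (@continuous_comp _ _ _ (fun y : R => Num.sqrt (1 - y ^+ 2)) (fun z => z ^+ e)).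
  exact: c1.
exact: exprn_continuous.
Qed.

Lemma integrable_sqrt1BX2 k e :
  mu.-integrable `[-1, 1] (EFin \o (fun y : R => y ^+ k * Num.sqrt (1 - y ^+ 2) ^+ e)).
Proof.
apply: continuous_compact_integrable; first exact: segment_compact.
by apply: continuous_subspaceT; exact: continuous_sqrt1BX2.
Qed.

Lemma is_derive_sqrt1BX2 k e (y : R) : `|y| < 1 ->
  is_derive y 1 (fun y : R => y ^+ k * Num.sqrt (1 - y ^+ 2) ^+ e.+2)
    (k%:R * (y ^+ k.-1 * Num.sqrt (1 - y ^+ 2) ^+ e.+2)
     - e.+2%:R * (y ^+ k.+1 * Num.sqrt (1 - y ^+ 2) ^+ e)).
Proof.
move=> y1; have r0 : 0 < 1 - y ^+ 2 by rewrite subr_gt0 -real_normK ?num_real// expr_lt1.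
have s0 : Num.sqrt (1 - y ^+ 2) != 0 by rewrite gt_eqF// sqrtr_gt0.
have hornerE1 : (1 - 'X^2 : {poly R}).[y] = 1 - y ^+ 2 by rewrite !hornerE.
have dpoly : is_derive y (1 : R) (horner (1 - 'X^2)) (- (2 * y)).
  by apply: is_derive_eq; rewrite !poly.derivE !hornerE /= mulr2n; ring.
have dsqrt : is_derive y (1 : R) (Num.sqrt \o horner (1 - 'X^2))
    ((2 * Num.sqrt (1 - y ^+ 2))^-1 * (- (2 * y))).
  by apply: is_derive1_comp; rewrite hornerE1; exact: is_derive1_sqrt.
have dXk : is_derive y (1 : R) (horner 'X^k) (k%:R * y ^+ k.-1).
  by apply: is_derive_eq; rewrite derivXn hornerMn hornerXn mulr_natl.
have := is_deriveM dXk (is_deriveX e.+2 dsqrt).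
rewrite (_ : horner 'X^k * (Num.sqrt \o horner (1 - 'X^2)) ^+ e.+2 =
  (fun y : R => y ^+ k * Num.sqrt (1 - y ^+ 2) ^+ e.+2)); last first.
  by apply/funext => z; rewrite !fctE /= !hornerE.
move=> dprod; apply: is_derive_eq; rewrite /= exprfctE /= hornerE1 hornerXn /GRing.scale /=.
move: s0 (e.+2%:R : R) => /[swap] E; move: (Num.sqrt _) => S S0.
by rewrite !exprS; field; rewrite S0.
Qed.

(* The integrated derivative is that of [y ^ k * (1 - y^2) ^ (e/2 + 1)], which
   vanishes at [-1] and [1]. *)
Lemma slice_moment_parts k e :
  k%:R * slice_moment k.-1 e.+2 = e.+2%:R * slice_moment k.+1 e.
Proof.
pose F := fun y : R => y ^+ k * Num.sqrt (1 - y ^+ 2) ^+ e.+2.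
pose f := fun y : R => k%:R * (y ^+ k.-1 * Num.sqrt (1 - y ^+ 2) ^+ e.+2)
     - e.+2%:R * (y ^+ k.+1 * Num.sqrt (1 - y ^+ 2) ^+ e).
have cF : continuous F by exact: continuous_sqrt1BX2.
have dF y : y \in `]-1, 1[ -> is_derive y 1 F (f y).
  by rewrite in_itv/= -ltr_norml; exact: is_derive_sqrt1BX2.
have F0 : \int[mu]_(y in `[-1, 1]) f y = 0.
  rewrite /Rintegral (@continuous_FTC2 _ f F) ?gtrN//.
  - by rewrite -EFinB/= /F expr1n sqrrN expr1n subrr sqrtr0 !expr0n /= !mulr0 subrr.
  - apply: continuous_subspaceT => y; apply: cvgB; apply: cvgM;
      [exact: cvg_cst|exact: continuous_sqrt1BX2|exact: cvg_cst|exact: continuous_sqrt1BX2].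
  - split; first by move=> y /dF[].
    + by apply: cvg_at_right_filter; exact: cF.
    + by apply: cvg_at_left_filter; exact: cF.
  - by move=> y /dF[_]; rewrite derive1E.
move: F0; rewrite /f RintegralB//; last 2 first.
- exact: (integrableZl _ k%:R (integrable_sqrt1BX2 k.-1 e.+2)).
- exact: (integrableZl _ e.+2%:R (integrable_sqrt1BX2 k.+1 e)).
rewrite !RintegralZl//; try exact: integrable_sqrt1BX2.
by rewrite -!slice_moment_itv => /eqP; rewrite subr_eq0 => /eqP.
Qed.

Lemma slice_momentSS k e : slice_moment k e.+2 = slice_moment k e - slice_moment k.+2 e.
Proof.
rewrite /slice_moment -RintegralB//; try exact: integrable_slice.
apply: eq_Rintegral => y _; rewrite /halfpow.
case: ifPn => rho_ge0; last by rewrite !mulr0 subr0.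
by rewrite -[in LHS](addn2 e) exprD sqr_sqrtr// -(addn2 k) exprD; ring.
Qed.

Lemma slice_moment_recl k e :
  (k + e.+2)%:R * slice_moment k.+1 e = k%:R * slice_moment k.-1 e.
Proof.
case: k => [|k]; first by rewrite add0n -slice_moment_parts !mul0r.
have := slice_moment_parts k.+1 e; rewrite /= slice_momentSS natrD => parts.
by rewrite mulrDl -parts; ring.
Qed.

Lemma slice_moment_recr k e :
  (k + e.+3)%:R * slice_moment k e.+2 = e.+2%:R * slice_moment k e.
Proof.
have := slice_moment_recl k.+1 e; rewrite /= addSnnS => recl.
by rewrite slice_momentSS mulrBr recl -!natr1 natrD -!natr1; ring.
Qed.

End slice_moments.

Section ball_moments.
Context {R : realType}.
Local Notation mu := (@lebesgue_measure R).
Implicit Types (n : nat) (rho : R) (s : seq R).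

Definition sqnorm n s : R := \sum_(i < n) nth 0 s i ^+ 2.

Definition monomial n (a : 'I_n -> nat) s : R := \prod_(i < n) nth 0 s i ^+ a i.

(* The degree in the radius of the integral of the monomial over a ball. *)
Definition degD n (a : 'I_n -> nat) : nat := \sum_(i < n) a i + n.

Fixpoint ball_moment n : ('I_n -> nat) -> R :=
  match n with
  | 0 => fun=> 1
  | n'.+1 => fun a =>
      let a' i := a (lift ord0 i) in slice_moment (a ord0) (degD a') * ball_moment a'
  end.

Lemma sqnorm_cons n y s : sqnorm n.+1 (y :: s) = y ^+ 2 + sqnorm n s.
Proof. by rewrite /sqnorm big_ord_recl. Qed.

Lemma monomial_cons n (a : 'I_n.+1 -> nat) y s :
  monomial a (y :: s) = y ^+ a ord0 * monomial (fun i => a (lift ord0 i)) s.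
Proof. by rewrite /monomial big_ord_recl. Qed.

Lemma degD_recl n (a : 'I_n.+1 -> nat) :
  degD a = (a ord0 + degD (fun i => a (lift ord0 i))).+1.
Proof. by rewrite /degD big_ord_recl addnS addnA. Qed.

Lemma normr_nth_le1 n s (i : 'I_n) : sqnorm n s <= 1 -> `|nth 0 s i| <= 1.
Proof.
move=> s1; rewrite -(@expr_le1 _ 2)// real_normK ?num_real//; apply: le_trans s1.
by rewrite /sqnorm (bigD1 i)//= lerDl; apply: sumr_ge0 => j _; exact: sqr_ge0.
Qed.

Lemma measurable_nth n (i : 'I_n) :
  measurable_fun [set: n.-tuple R] (fun s : n.-tuple R => nth 0 s i).
Proof.
rewrite (_ : (fun s : n.-tuple R => _) = (@tnth n R ^~ i)); first exact: measurable_tnth.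
by apply/funext => s; rewrite (tnth_nth 0).
Qed.

Lemma measurable_sqnorm n :
  measurable_fun [set: n.-tuple R] (fun s : n.-tuple R => sqnorm n s).
Proof. by apply: measurable_sum => i; apply: measurable_funX; exact: measurable_nth. Qed.

Lemma measurable_monomial n (a : 'I_n -> nat) :
  measurable_fun [set: n.-tuple R] (fun s : n.-tuple R => monomial a s).
Proof. by apply: measurable_prod => i _; apply: measurable_funX; exact: measurable_nth. Qed.

Lemma cube_bounded_if n (P : seq R -> bool) (F : seq R -> R) (M : R) : 0 <= M ->
  (forall s, P s -> sqnorm n s <= 1) -> (forall s, P s -> `|F s| <= M) ->
  cube_bounded n (fun s => (if P s then 1 else 0) * F s) M.
Proof.
move=> M0 P1 FM s; case: ifPn => Ps; last first.
  by rewrite mul0r normr0 mulr_ge0// cube_indic_ge0.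
rewrite mul1r cube_indic1 ?mulr1 ?FM// => x /tnthP[i ->].
by rewrite (tnth_nth 0) normr_nth_le1// P1.
Qed.

Lemma cube_integrand_ball_monomial n (a : 'I_n -> nat) rho : rho <= 1 ->
  cube_integrand n (fun s => (if sqnorm n s <= rho then 1 else 0) * monomial a s).
Proof.
move=> rho1; split.
  apply: measurable_funM; last exact: measurable_monomial.
  apply: measurable_fun_ifT => //.
  by apply: measurable_fun_ler => //; exact: measurable_sqnorm.
exists 1; apply: (cube_bounded_if ler01) => s srho; have s1 := le_trans srho rho1 => //.
rewrite /monomial normr_prod; apply: prodr_ile1 => i _.
by rewrite normr_ge0 /= normrX exprn_ile1// normr_nth_le1.
Qed.

Lemma iint_ball_monomial n (a : 'I_n -> nat) rho : rho <= 1 ->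
  iint n (fun s => (if sqnorm n s <= rho then 1 else 0) * monomial a s)
  = ball_moment a * halfpow rho (degD a).
Proof.
elim: n a rho => [|n IH] a rho rho1 /=.
  by rewrite /sqnorm /monomial /degD !big_ord0 /halfpow addn0 expr0 mulr1 mul1r.
set a' := fun i => a (lift ord0 i).
transitivity (\int[mu]_y
    (ball_moment a' * (y ^+ a ord0 * halfpow (rho - y ^+ 2) (degD a')))).
  apply: eq_Rintegral => y _.
  have rhoy1 : rho - y ^+ 2 <= 1 by rewrite (le_trans _ rho1)// gerBl sqr_ge0.
  rewrite mulrCA -IH// -iintZ; last exact: cube_integrand_ball_monomial.
  by apply: eq_iint => s _; rewrite sqnorm_cons monomial_cons lerBrDl mulrCA.
rewrite RintegralZl//; last exact: integrable_slice.
by rewrite Rintegral_slice mulrCA mulrA degD_recl.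
Qed.

Lemma degD_incr n (a : 'I_n -> nat) i : degD (fun j => (i == j) + a j)%N = (degD a).+1.
Proof.
rewrite /degD big_split/= (bigD1 i)//= eqxx big1 ?addn0 ?add1n// => j.
by rewrite eq_sym => /negbTE ->.
Qed.

Lemma degD_decr n (a : 'I_n -> nat) i : (0 < a i)%N ->
  (degD (fun j => a j - (i == j))%N).+1 = degD a.
Proof.
move=> ai; rewrite -(degD_incr _ i); congr degD; apply/funext => j.
by case: eqP => [<-|]; rewrite ?subnKC ?subn0.
Qed.

Lemma ball_moment_incr n (a : 'I_n -> nat) i :
  (degD a).+1%:R * ball_moment (fun j => (i == j) + a j)%N =
  (a i)%:R * ball_moment (fun j => a j - (i == j))%N.
Proof.
elim: n a i => [|n IH] a i; first by case: i.
rewrite /= degD_recl; pose a' j := a (lift ord0 j).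
case: (unliftP ord0 i) => [j|] -> /=; last first.
  have -> : (fun j : 'I_n => (ord0 == lift ord0 j) + a' j)%N = a' by [].
  have -> : (fun j => a' j - (ord0 == lift ord0 j))%N = a' by apply/funext => j; rewrite subn0.
  by rewrite !mulrA add1n subn1 -slice_moment_recl !addnS.
have -> : (fun k => (lift ord0 j == lift ord0 k) + a' k)%N = (fun k => (j == k) + a' k)%N.
  by apply/funext => k; rewrite (inj_eq lift_inj).
have -> : (fun k => a' k - (lift ord0 j == lift ord0 k))%N = (fun k => a' k - (j == k))%N.
  by apply/funext => k; rewrite (inj_eq lift_inj).
have := @slice_moment_recr R (a ord0) (degD (fun k => a' k - (j == k))%N).
rewrite subn0 add0n degD_incr -/(a' j) !mulrA -2![(_ + _).+1]addnS.
case: (posnP (a' j)) => [aj0|aj_gt0].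
  have := IH a' j; rewrite aj0 mul0r => /eqP.
  by rewrite mulf_eq0 pnatr_eq0/= => /eqP ->; rewrite !mulr0 !mul0r.
by rewrite degD_decr// => ->; rewrite -mulrA mulrCA IH mulrCA mulrA.
Qed.

End ball_moments.

Section ball_integral.
Context {R : realType} {d : nat}.
Implicit Types (s : seq R) (x : 'rV[R]_d) (r c : R) (g : 'rV[R]_d -> R).

Definition row_of s : 'rV[R]_d := \row_i nth 0 s i.

Definition ball_indic r x : R := if enorm x <= r then 1 else 0.

Definition ball_int r g : R := lebint (fun x => ball_indic r x * g x).

Definition ball_integrand g :=
  measurable_fun [set: d.-tuple R] (fun s : d.-tuple R => g (row_of s)) /\
  exists2 M, 0 <= M & forall x, enorm x <= 1 -> `|g x| <= M.

Lemma enorm_ge0 x : 0 <= enorm x.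
Proof. exact: sqrtr_ge0. Qed.

Lemma normr_coord_le x i : `|x ord0 i| <= enorm x.
Proof.
rewrite -sqrtr_sqr ler_wsqrtr// (bigD1 i)//= lerDl.
by apply: sumr_ge0 => j _; exact: sqr_ge0.
Qed.

Lemma enorm0_eq0 x : enorm x = 0 -> x = 0.
Proof.
move=> x0; apply/rowP => i; rewrite mxE; apply/eqP.
by rewrite -normr_le0 -x0 normr_coord_le.
Qed.

Lemma enormZ c x : enorm (c *: x) = `|c| * enorm x.
Proof.
rewrite /enorm -sqrtr_sqr -sqrtrM ?sqr_ge0// mulr_sumr; congr Num.sqrt.
by apply: eq_bigr => i _; rewrite mxE exprMn.
Qed.

Lemma enormVZ x : enorm x *: ((enorm x)^-1 *: x) = x.
Proof.
rewrite scalerA; have [/enorm0_eq0 ->|x0] := eqVneq (enorm x) 0; first by rewrite scaler0.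
by rewrite divff// scale1r.
Qed.

Lemma enorm_row_of s : enorm (row_of s) = Num.sqrt (sqnorm d s).
Proof. by rewrite /enorm /sqnorm; congr Num.sqrt; apply: eq_bigr => i _; rewrite mxE. Qed.

Lemma enorm_row_of_le r s : 0 <= r -> (enorm (row_of s) <= r) = (sqnorm d s <= r ^+ 2).
Proof.
move=> r0; rewrite -[r in LHS]ger0_norm// -sqrtr_sqr enorm_row_of ler_sqrt//.
exact: sqr_ge0.
Qed.

Lemma row_of_scale c s : size s = d -> row_of [seq c * y | y <- s] = c *: row_of s.
Proof. by move=> sd; apply/rowP => i; rewrite !mxE (nth_map 0)// sd. Qed.

Lemma ball_indicZ c r x : 0 < c -> ball_indic r (c^-1 *: x) = ball_indic (c * r) x.
Proof.
by move=> c0; rewrite /ball_indic enormZ gtr0_norm ?invr_gt0// ler_pdivrMl.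
Qed.

Lemma measurable_row_of i :
  measurable_fun [set: d.-tuple R] (fun s : d.-tuple R => row_of s ord0 i).
Proof.
rewrite (_ : (fun s : d.-tuple R => _) = (fun s : d.-tuple R => nth 0 s i)).
  exact: measurable_nth.
by apply/funext => s; rewrite mxE.
Qed.

Lemma measurable_enorm :
  measurable_fun [set: d.-tuple R] (fun s : d.-tuple R => enorm (row_of s)).
Proof.
rewrite (_ : (fun s : d.-tuple R => _) = Num.sqrt \o (fun s : d.-tuple R => sqnorm d s)).
  by apply: measurableT_comp; [exact: measurable_sqrt|exact: measurable_sqnorm].
by apply/funext => s; rewrite enorm_row_of.
Qed.

Lemma cube_bounded_ball r g M : r <= 1 -> 0 <= M ->
  (forall x, enorm x <= 1 -> `|g x| <= M) ->
  cube_bounded d (fun s => ball_indic r (row_of s) * g (row_of s)) M.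
Proof.
move=> r1 M0 gM; apply: cube_bounded_if => // s sr; have s1 := le_trans sr r1.
  by rewrite -[1](expr1n _ 2) -enorm_row_of_le.
exact: gM.
Qed.

Lemma cube_integrand_ball_indic r g : r <= 1 -> ball_integrand g ->
  cube_integrand d (fun s => ball_indic r (row_of s) * g (row_of s)).
Proof.
move=> r1 [mg [M M0 gM]]; split; last by exists M; exact: cube_bounded_ball.
apply: measurable_funM mg; apply: measurable_fun_ifT => //.
by apply: measurable_fun_ler => //; exact: measurable_enorm.
Qed.

Lemma ball_intD r g g' : r <= 1 -> ball_integrand g -> ball_integrand g' ->
  ball_int r (fun x => g x + g' x) = ball_int r g + ball_int r g'.
Proof.
move=> r1 bg bg'; rewrite -[RHS]iintD; try exact: cube_integrand_ball_indic.
by apply: eq_iint => s _; rewrite mulrDr.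
Qed.

Lemma ball_intZ r c g : r <= 1 -> ball_integrand g ->
  ball_int r (fun x => c * g x) = c * ball_int r g.
Proof.
move=> r1 bg; rewrite -[RHS]iintZ; last exact: cube_integrand_ball_indic.
by apply: eq_iint => s _; rewrite mulrCA.
Qed.

Lemma ball_integrandM g g' : ball_integrand g -> ball_integrand g' ->
  ball_integrand (fun x => g x * g' x).
Proof.
move=> [mg [M M0 gM]] [mg' [M' M'0 gM']]; split; first exact: measurable_funM.
by exists (M * M'); rewrite ?mulr_ge0// => x x1; rewrite normrM ler_pM ?gM ?gM'.
Qed.

Lemma ball_integrand_enormX k : ball_integrand (fun x => enorm x ^+ k).
Proof.
split; first by apply: measurable_funX; exact: measurable_enorm.
by exists 1 => // x x1; rewrite normrX exprn_ile1// ger0_norm// enorm_ge0.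
Qed.

Lemma ball_integrand_1BenormX k : ball_integrand (fun x => 1 - enorm x ^+ k).
Proof.
split; first by apply: measurable_funB => //; apply: measurable_funX; exact: measurable_enorm.
exists 1 => // x x1; rewrite ger0_norm ?gerBl ?exprn_ge0 ?enorm_ge0//.
by rewrite subr_ge0 exprn_ile1// enorm_ge0.
Qed.

Lemma ball_int_homog0 r g : 0 < r -> ball_integrand g ->
  (forall (c : R) x, 0 < c -> g (c *: x) = g x) -> ball_int r g = r ^+ d * ball_int 1 g.
Proof.
move=> r0 bg g_homog; have ri0 : 0 < r^-1 by rewrite invr_gt0.
have := iint_scale (lt0r_neq0 ri0) (cube_integrand_ball_indic (lexx 1) bg).
rewrite gtr0_norm// exprVn invrK => <-.
by apply: eq_iint => s sd; rewrite row_of_scale// ball_indicZ// mulr1 g_homog.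
Qed.

End ball_integral.

Arguments row_of {R} d s.

Section radial_integral.
Context {R : realType} {d : nat}.
Local Notation mu := (@lebesgue_measure R).
Implicit Types (r : R) (x : 'rV[R]_d) (g : 'rV[R]_d -> R) (k : nat).

Lemma Rintegral_layer (p : {poly R}) (e : R) : 0 <= e ->
  \int[mu]_(r in `]0, 1]) (p^`().[r] * (if e <= r then 1 else 0))
  = (if e <= 1 then 1 else 0) * (p.[1] - p.[e]).
Proof.
rewrite le_eqVlt => /predU1P[<-|e0].
  rewrite ler01 mul1r -Rintegral_deriv_horner_itvoc.
  by apply: eq_Rintegral => r; rewrite inE/= in_itv/= => /andP[r0 _]; rewrite ltW// mulr1.
case: (leP e 1) => e1; last first.
  rewrite mul0r; apply: Rintegral0_eq => r; rewrite /= in_itv/= => /andP[_ r1].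
  by rewrite leNgt (le_lt_trans r1 e1) mulr0.
rewrite mul1r -Rintegral_deriv_horner// Rintegral_mkcond [RHS]Rintegral_mkcond.
apply: eq_Rintegral => r _; rewrite !patchE !mem_setE !in_itv/=.
case: (leP e r) => er; last by rewrite mulr0; case: ifP.
by rewrite (lt_le_trans e0 er) mulr1.
Qed.

Section layers.
Variables (g : 'rV[R]_d -> R) (k : nat).
Hypotheses (bg : ball_integrand g) (g_homog : forall (c : R) x, 0 < c -> g (c *: x) = g x).

Let layer r s : R :=
  \1_`]0, 1]%classic r * (('X^(k.+1))^`().[r] * (ball_indic r (row_of d s) * g (row_of d s))).

Let measurable_layer :
  measurable_fun [set: R * d.-tuple R] (fun p : R * d.-tuple R => layer p.1 p.2).
Proof.
have [mg _] := bg.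
apply: measurable_funM; first exact: measurableT_comp.
apply: measurable_funM.
  exact: (measurableT_comp (measurable_horner _)).
apply: measurable_funM; last exact: (measurableT_comp mg).
apply: measurable_fun_ifT => //; apply: measurable_fun_ler => //.
exact: (measurableT_comp measurable_enorm).
Qed.

Let layer_bounded : exists M, forall r, cube_bounded d (layer r) (M * \1_`]0, 1]%classic r).
Proof.
have [_ [M M0 gM]] := bg; exists (k.+1%:R * M) => r s.
rewrite /layer indicE mem_setE in_itv/=.
case: (boolP (0 < r <= 1)) => [/andP[r0 r1]|_]; last by rewrite mul0r mulr0 normr0 mul0r.
rewrite mul1r mulr1 normrM -mulrA ler_pM ?(cube_bounded_ball r1 M0 gM)//.
rewrite derivXn hornerMn hornerXn normrMn ler_wMn2r// normrX exprn_ile1//.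
by rewrite ger0_norm// ltW.
Qed.

Let Rintegral_layer_radius s : \int[mu]_r layer r s =
  ball_indic 1 (row_of d s) * ((1 - enorm (row_of d s) ^+ k.+1) * g (row_of d s)).
Proof.
rewrite Rintegral_indicM.
pose p : {poly R} := g (row_of d s) *: 'X^(k.+1).
transitivity (\int[mu]_(r in `]0, 1])
    (p^`().[r] * (if enorm (row_of d s) <= r then 1 else 0))).
  by apply: eq_Rintegral => r _; rewrite derivZ hornerZ mulrA mulrC mulrA.
rewrite Rintegral_layer ?enorm_ge0// !hornerZ !hornerXn expr1n; congr (_ * _).
by rewrite -mulrBr mulrC.
Qed.

Let Rintegral_layer_space :
  (k.+1 + d)%:R * \int[mu]_r iint d (layer r) = k.+1%:R * ball_int 1 g.
Proof.
pose p : {poly R} := (k.+1%:R * ball_int 1 g / (k.+1 + d)%:R) *: 'X^(k.+1 + d).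
have kd0 : (k.+1 + d)%:R != 0 :> R by rewrite pnatr_eq0.
transitivity ((k.+1 + d)%:R * (p.[1] - p.[0])); last first.
  by rewrite !hornerZ !hornerXn expr1n expr0n mulr0 subr0 mulr1 mulrC divfK.
congr (_ * _); rewrite -Rintegral_deriv_horner_itvoc -[RHS]Rintegral_indicM.
apply: eq_Rintegral => r _; rewrite /layer indicE mem_setE in_itv/=.
case: (boolP (0 < r <= 1)) => [/andP[r0 r1]|_]; last first.
  by rewrite mul0r -[RHS](iint0 d); apply: eq_iint => s _; rewrite mul0r.
rewrite mul1r; transitivity (('X^(k.+1))^`().[r] * ball_int r g).
  rewrite -iintZ; first by apply: eq_iint => s _; rewrite mul1r.
  exact: cube_integrand_ball_indic.
rewrite ball_int_homog0// /p derivZ !derivXn hornerZ !hornerMn !hornerXn /= exprD.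
by rewrite -[r ^+ k *+ _]mulr_natl -[(_ * _) *+ _]mulr_natl; field.
Qed.

(* Layer cake: integrating [k r^(k-1) g(x)] over [|x| <= r <= 1] first in [r] weighs [g] by
   [1 - |x|^k], and first in [x] gives [k r^(k+d-1)] times the integral over the unit ball. *)
Lemma ball_int_radialS : (k.+1 + d)%:R * ball_int 1 (fun x => enorm x ^+ k.+1 * g x)
  = d%:R * ball_int 1 g.
Proof.
have [M layerM] := layer_bounded.
have mD : measurable (`]0, 1]%classic : set R) by [].
have := Rintegral_layer_space.
rewrite (Rintegral_iint (nu := mu) mD _ measurable_layer layerM); last first.
  exact: lebesgue_measure_itv_lty.
have -> : iint d (fun s => \int[mu]_r layer r s) =
    ball_int 1 (fun x => (1 - enorm x ^+ k.+1) * g x).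
  by apply: eq_iint => s _; rewrite Rintegral_layer_radius.
move=> layerE; have : ball_int 1 g = ball_int 1 (fun x => (1 - enorm x ^+ k.+1) * g x)
    + ball_int 1 (fun x => enorm x ^+ k.+1 * g x).
  rewrite -ball_intD//; first by apply: eq_iint => s _; rewrite -mulrDl subrK mul1r.
    by apply: ball_integrandM => //; exact: ball_integrand_1BenormX.
  by apply: ball_integrandM => //; exact: ball_integrand_enormX.
move=> /(congr1 (fun y => (k.+1 + d)%:R * y)); rewrite mulrDr layerE natrD mulrDl.
by move=> /addrI <-.
Qed.

End layers.

Lemma ball_int_radial k g : ball_integrand g ->
  (forall (c : R) x, 0 < c -> g (c *: x) = g x) ->
  (k + d)%:R * ball_int 1 (fun x => enorm x ^+ k * g x) = d%:R * ball_int 1 g.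
Proof.
case: k => [_ _|k]; last exact: ball_int_radialS.
by rewrite add0n; congr (_ * _); apply: eq_iint => s _; rewrite expr0 mul1r.
Qed.

End radial_integral.

Local Notation "k .-homog" := (@ishomog1 _ _ k mdeg) (at level 1, format "k .-homog").
Local Notation "''X_[' m ]" := (mpolyX _ m) (at level 8, format "''X_[' m ]").
Local Notation "''X_' i" := (mpolyX _ (mnm1 i)) (at level 8, i at level 2, format "''X_' i").

Section harmonic_polynomials.
Context {R : realType} {d : nat}.
Implicit Types (p q : mpoly d R) (m : multinom d) (x : 'rV[R]_d) (c : R) (k l : nat).

Definition laplacian p : mpoly d R := \sum_(i < d) mderiv i (mderiv i p).

Lemma pevalE p x :
  peval p x = \sum_(m <- msupp p) mcoeff m p * \prod_(i < d) x ord0 i ^+ m i.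
Proof. exact: mevalE. Qed.

Lemma pevalM p q x : peval (p * q) x = peval p x * peval q x.
Proof. exact: mevalM. Qed.

Lemma mulr_peval p q : (fun x => peval p x * peval q x) = peval (p * q).
Proof. by apply/funext => x; rewrite pevalM. Qed.

Lemma homogP k p : reflect {in msupp p, forall m, mdeg m = k} (p \is k.-homog).
Proof. exact: dhomogP. Qed.

Lemma peval_homogZ k p c x : p \is k.-homog -> peval p (c *: x) = c ^+ k * peval p x.
Proof.
move=> /homogP hp; rewrite !pevalE mulr_sumr big_seq [RHS]big_seq.
apply: eq_bigr => m /hp <-; rewrite mulrCA mdegE; congr (_ * _).
by under [LHS]eq_bigr do rewrite mxE exprMn; rewrite big_split/= expr_sum.
Qed.

Lemma mderivX_mul m i : 'X_i * mderiv i 'X_[m] = (m i)%:R *: 'X_[m] :> mpoly d R.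
Proof.
rewrite mderivX -scalerAr; case: (posnP (m i)) => [->|mi]; first by rewrite !scale0r.
by rewrite -mpolyXD; congr (_ *: 'X_[_]); rewrite addmC submK// lep1mP -lt0n.
Qed.

Lemma euler_homog k p : p \is k.-homog -> \sum_(i < d) 'X_i * mderiv i p = k%:R *: p.
Proof.
move=> /homogP hp; rewrite [in LHS](mpolyE p) [in RHS](mpolyE p) scaler_sumr.
under eq_bigr do rewrite raddf_sum mulr_sumr.
rewrite exchange_big /= big_seq [RHS]big_seq; apply: eq_bigr => m /hp <-.
under eq_bigr do rewrite mderivZ -scalerAr mderivX_mul scalerA mulrC -scalerA.
by rewrite -scaler_suml -natr_sum -mdegE.
Qed.

Lemma homog_mderiv k p i : p \is k.+1.-homog -> mderiv i p \is k.-homog.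
Proof.
move=> /homogP hp; apply/homogP => m; rewrite mcoeff_msupp mcoeff_deriv => pm.
have /hp : mnm_add m (mnm1 i) \in msupp p.
  by rewrite mcoeff_msupp; apply: contraNneq pm => ->; rewrite mul0rn.
by rewrite mdegD mdeg1 addn1 => -[].
Qed.

Lemma homog0_mderiv p i : p \is 0.-homog -> mderiv i p = 0.
Proof.
move=> /homogP hp; rewrite [p]mpolyE raddf_sum /= big_seq big1// => m /hp.
by move=> /eqP; rewrite mdeg_eq0 => /eqP ->; rewrite mderivZ mpolyX0 mderivC scaler0.
Qed.

End harmonic_polynomials.

Section ball_integral_polynomial.
Context {R : realType} {d : nat}.
Implicit Types (p q : mpoly d R) (m : multinom d) (x : 'rV[R]_d) (c : R) (k l : nat).

Definition poly_ball_int p : R := ball_int 1 (peval p).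

Lemma normr_peval_le p x : (forall i, `|x ord0 i| <= 1) ->
  `|peval p x| <= \sum_(m <- msupp p) `|mcoeff m p|.
Proof.
move=> x1; rewrite pevalE (le_trans (ler_norm_sum _ _ _))//.
apply: ler_sum => m _; rewrite normrM ler_piMr// normr_prod.
by apply: prodr_ile1 => i _; rewrite normr_ge0 normrX exprn_ile1.
Qed.

Lemma ball_integrand_peval (h : 'rV[R]_d -> 'rV[R]_d) p :
  (forall i, measurable_fun [set: d.-tuple R] (fun s : d.-tuple R => h (row_of d s) ord0 i)) ->
  (forall x i, enorm x <= 1 -> `|h x ord0 i| <= 1) ->
  ball_integrand (fun x => peval p (h x)).
Proof.
move=> mh h1; split.
  rewrite (_ : (fun s : d.-tuple R => _) = (fun s : d.-tuple R => \sum_(m <- msupp p)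
      mcoeff m p * \prod_(i < d) h (row_of d s) ord0 i ^+ m i)).
    apply: measurable_sum => m; apply: measurable_funM => //.
    by apply: measurable_prod => i _; exact: measurable_funX.
  by apply/funext => s; rewrite pevalE.
exists (\sum_(m <- msupp p) `|mcoeff m p|); first exact: sumr_ge0.
by move=> x x1; apply: normr_peval_le => i; exact: h1.
Qed.

Lemma ball_integrand_peval_id p : ball_integrand (peval p).
Proof.
apply: (ball_integrand_peval (h := id)); first exact: measurable_row_of.
by move=> x i; exact: le_trans (normr_coord_le x i).
Qed.

Lemma ball_integrand_peval_sphere p : ball_integrand (fun x => peval p ((enorm x)^-1 *: x)).
Proof.
apply: (ball_integrand_peval (h := fun x => (enorm x)^-1 *: x)) => [i|x i _].
  rewrite (_ : (fun s : d.-tuple R => _) =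
      (fun s : d.-tuple R => powR (enorm (row_of d s)) (-1) * row_of d s ord0 i)).
    apply: measurable_funM; last exact: measurable_row_of.
    by apply: (measurableT_comp (measurable_powR (-1))); exact: measurable_enorm.
  by apply/funext => s; rewrite mxE powR_inv1 ?enorm_ge0.
rewrite mxE normrM ger0_norm ?invr_ge0 ?enorm_ge0//.
have := normr_coord_le x i; have := enorm_ge0 x.
rewrite le_eqVlt => /predU1P[<- _|x0 xi].
  by rewrite invr0 mul0r.
by rewrite ler_pdivrMl ?mulr1.
Qed.

Lemma poly_ball_int_is_linear : linear poly_ball_int.
Proof.
move=> c p q; transitivity (ball_int 1 (fun x => peval (c *: p) x + peval q x)).
  by congr ball_int; apply/funext => x; rewrite /peval mevalD.
rewrite ball_intD//; try exact: ball_integrand_peval_id.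
congr (_ + _); rewrite -[RHS]ball_intZ//; last exact: ball_integrand_peval_id.
by congr ball_int; apply/funext => x; rewrite /peval mevalZ.
Qed.

HB.instance Definition _ :=
  GRing.isLinear.Build R (mpoly d R) R _ poly_ball_int poly_ball_int_is_linear.

Lemma poly_ball_intX m : poly_ball_int 'X_[m] = ball_moment (fun i => m i).
Proof.
have := iint_ball_monomial (fun i => m i) (lexx (1 : R)).
rewrite /halfpow ler01 sqrtr1 expr1n mulr1 => <-.
apply: eq_iint => s _; rewrite -/(row_of d s) /ball_indic enorm_row_of_le// expr1n.
rewrite /peval mevalX; congr (_ * _).
by apply: eq_bigr => i _; rewrite mxE.
Qed.

Lemma poly_ball_int_mderivX m i :
  poly_ball_int (mderiv i 'X_[m]) = (mdeg m + d).+1%:R * poly_ball_int ('X_i * 'X_[m]).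
Proof.
rewrite mderivX linearZ/= -mpolyXD !poly_ball_intX mdegE.
have -> : (fun j => mnm_add (mnm1 i) m j) = (fun j => (i == j) + m j)%N.
  by apply/funext => j; rewrite mnmDE mnm1E.
have -> : (fun j => mnm_sub m (mnm1 i) j) = (fun j => m j - (i == j))%N.
  by apply/funext => j; rewrite mnmBE mnm1E.
by rewrite ball_moment_incr.
Qed.

(* The divergence theorem on the unit ball: on the boundary the outward normal
   is [x] itself, and homogeneity turns the boundary integral back into an
   integral over the ball. *)
Lemma poly_ball_int_mderiv k p i : p \is k.-homog ->
  poly_ball_int (mderiv i p) = (k + d).+1%:R * poly_ball_int ('X_i * p).
Proof.
move=> /homogP hp; rewrite [p]mpolyE [mderiv i _]raddf_sum mulr_sumr !raddf_sum mulr_sumr.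
rewrite big_seq [RHS]big_seq; apply: eq_bigr => m /hp <-.
by rewrite /= mderivZ -scalerAr !linearZ/= poly_ball_int_mderivX mulrCA.
Qed.

Lemma poly_ball_int_grad k l p q : p \is k.-homog -> q \is l.-homog -> laplacian q = 0 ->
  \sum_(i < d) poly_ball_int (mderiv i p * mderiv i q) =
  (k + l + d)%:R * (l%:R * poly_ball_int (p * q)).
Proof.
move=> hp hq lap_q.
have green i : poly_ball_int (mderiv i (p * mderiv i q))
    = (k + l + d)%:R * poly_ball_int (p * ('X_i * mderiv i q)).
  case: l hq => [|l] hq; first by rewrite (homog0_mderiv _ hq) !mulr0 mderiv0 linear0 mulr0.
  have /poly_ball_int_mderiv -> := dhomogM hp (homog_mderiv i hq).
  by rewrite addnS addSn mulrCA.
transitivity (\sum_(i < d) poly_ball_int (mderiv i (p * mderiv i q))).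
  rewrite -!raddf_sum; under [in RHS]eq_bigr do rewrite mderivM.
  by rewrite big_split/= -mulr_sumr -/(laplacian q) lap_q mulr0 addr0.
under eq_bigr do rewrite green.
by rewrite -mulr_sumr -raddf_sum -mulr_sumr (euler_homog hq) -scalerAr /= linearZ.
Qed.

Lemma poly_ball_int_harmonic_orth k l p q : p \is k.-homog -> q \is l.-homog ->
  laplacian p = 0 -> laplacian q = 0 -> k != l -> poly_ball_int (p * q) = 0.
Proof.
move=> hp hq lap_p lap_q kl; have := poly_ball_int_grad hq hp lap_p.
under eq_bigr do rewrite mulrC.
rewrite (poly_ball_int_grad hp hq lap_q) [q * p]mulrC [(l + k)%N]addnC => /eqP.
have kld0 : (k + l + d)%:R != 0 :> R.
  by rewrite pnatr_eq0 -lt0n; case: k l kl {hp hq} => [|k] [|l].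
rewrite (inj_eq (mulfI kld0)) -subr_eq0 -mulrBl mulf_eq0 => /orP[|/eqP//].
by rewrite subr_eq0 eqr_nat eq_sym (negbTE kl).
Qed.

Lemma sphere_intZ c p :
  sphere_int (fun xi => c * peval p xi) = c * sphere_int (peval p).
Proof.
rewrite mulrCA; congr (_ * _).
exact: (ball_intZ c (lexx 1) (ball_integrand_peval_sphere p)).
Qed.

Lemma sphere_int_homog k p : p \is k.-homog ->
  sphere_int (peval p) = (k + d)%:R * poly_ball_int p.
Proof.
move=> hp; pose g x := peval p ((enorm x)^-1 *: x).
have g_homog c x : 0 < c -> g (c *: x) = g x.
  move=> c0; rewrite /g enormZ gtr0_norm// invfM scalerA mulrAC mulVf ?mul1r//.
  by rewrite gt_eqF.
transitivity (d%:R * ball_int 1 g) => //.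
rewrite -(ball_int_radial k _ g_homog); last exact: ball_integrand_peval_sphere.
by congr (_ * ball_int _ _); apply/funext => x; rewrite -(peval_homogZ _ _ hp) enormVZ.
Qed.

Lemma homog_harmonicP k p : homog_harmonic k p -> p \is k.-homog /\ laplacian p = 0.
Proof. by case=> hp lap_p; split=> //; rewrite dhomogE. Qed.

Lemma sphere_int_harmonic_orth k l p q : homog_harmonic k p -> homog_harmonic l q ->
  k != l -> sphere_int (fun xi => peval p xi * peval q xi) = 0.
Proof.
move=> /homog_harmonicP[hp lap_p] /homog_harmonicP[hq lap_q] kl.
rewrite mulr_peval (sphere_int_homog (dhomogM hp hq)).
by rewrite (poly_ball_int_harmonic_orth hp hq)// mulr0.
Qed.

End ball_integral_polynomial.

Section power_integral.
Context {R : realType}.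
Local Notation mu := (@lebesgue_measure R).
Implicit Types (a b e : R) (p q : {poly R}).

Lemma is_derive_powR_primitive b e : 0 < b + 1 -> 0 < e ->
  is_derive e 1 (fun t => (b + 1)^-1 * powR t (b + 1)) (powR e b).
Proof.
move=> b0 e0; have := is_derive1_powR (b + 1) e0.
move=> /(is_deriveM (is_derive_cst (b + 1)^-1 e 1)) /=.
rewrite scaler0 addr0 addrK /GRing.scale/= mulrA mulVf ?mul1r//.
by rewrite gt_eqF.
Qed.

Lemma integral_powR_itvcc b e : 0 < b + 1 -> 0 < e < 1 ->
  (\int[mu]_(t in `[e, 1%R]) (powR t b)%:E = ((b + 1)^-1 * (1 - powR e (b + 1)))%:E)%E.
Proof.
move=> b0 /andP[e0 e1]; pose F t := (b + 1)^-1 * powR t (b + 1).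
have dF (t : R) : 0 < t -> is_derive t 1 F (powR t b) by exact: is_derive_powR_primitive.
have cF (t : R) : 0 < t -> {for t, continuous F}.
  by move=> /dF[dFt _]; apply: differentiable_continuous; exact/derivable1_diffP.
have gt0 (t : R) : t \in `]e, 1[ -> 0 < t.
  by rewrite in_itv/= => /andP[+ _]; exact: lt_trans.
rewrite (@continuous_FTC2 _ (fun t => powR t b) F)//.
- by rewrite -EFinB /F powR1 mulrBr.
- apply: derivable_within_continuous => t; rewrite in_itv/= => /andP[et _].
  by apply: derivable_powR; rewrite in_itv/= andbT (lt_le_trans e0).
- split; first by move=> t /gt0/dF[].
  + by apply: cvg_at_right_filter; exact: cF.
  + by apply: cvg_at_left_filter; exact: cF.
- by move=> t /gt0/dF[_]; rewrite derive1E.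
Qed.

Lemma bigcup_itvcc_invn : \bigcup_n `[n.+2%:R^-1, 1]%classic = `]0, 1]%classic :> set R.
Proof.
apply/seteqP; split => [t [n _]|t] /=; rewrite !in_itv/= => /andP[t0 t1].
  by rewrite t1 (lt_le_trans _ t0)// invr_gt0.
have [n _ tn] := near_infty_natSinv_lt (PosNum t0).
by exists n => //=; rewrite in_itv/= t1 andbT ltW//; exact: (tn n.+1 (leqnSn n)).
Qed.

Lemma cvg_powR_invn b : 0 < b -> powR (n.+2%:R^-1 : R) b @[n --> \oo] --> (0 : R).
Proof.
move=> b0; have /cvg_at_rightP := @powR_cvg0 R b b0; apply; split.
  by move=> n; rewrite invr_gt0.
by have := @cvg_harmonic R; rewrite -(cvg_shiftS (@harmonic R)).
Qed.

Lemma integral_powR_itvoc b : -1 < b ->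
  (\int[mu]_(t in `]0%R, 1%R]) (powR t b)%:E = ((b + 1)^-1)%:E)%E.
Proof.
move=> b1; have b0 : 0 < b + 1 by rewrite -ltrBlDr sub0r.
pose E n : set R := `[n.+2%:R^-1, 1]%classic.
have cvg_int : (\int[mu]_(t in E n) (powR t b)%:E @[n --> \oo] -->
    \int[mu]_(t in `]0%R, 1%R]) (powR t b)%:E)%E.
  rewrite -bigcup_itvcc_invn; apply: ge0_nondecreasing_set_cvg_integral => //.
  - move=> m n mn; apply/subsetPset => t; rewrite /E /= !in_itv/= => /andP[t0 ->].
    by rewrite andbT (le_trans _ t0)// lef_pV2 ?posrE// ler_nat !ltnS.
  - by move=> n; exact: measurable_itv.
  - by move=> n; apply/measurable_EFinP; apply: measurable_funTS; exact: measurable_powR.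
  - by move=> n t _; rewrite lee_fin powR_ge0.
suff : (\int[mu]_(t in E n) (powR t b)%:E @[n --> \oo] --> ((b + 1)^-1)%:E)%E.
  exact: cvg_unique cvg_int.
rewrite (_ : (fun n => _) =
    (fun n => ((b + 1)^-1 * (1 - powR n.+2%:R^-1 (b + 1)))%:E)); last first.
  by apply/funext => n; rewrite integral_powR_itvcc// invr_gt0 ltr0n/= invf_lt1 ?ltr1n.
apply: cvg_EFin; first by near=> n.
have := cvgM (cvg_cst (b + 1)^-1) (cvgB (cvg_cst (1 : R)) (cvg_powR_invn b0)).
by rewrite subr0 mulr1; exact.
Unshelve. all: by end_near. Qed.

Lemma integrable_powR b : -1 < b -> mu.-integrable `]0, 1] (EFin \o (@powR R ^~ b)).
Proof.
move=> b1; apply/integrableP; split.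
  by apply/measurable_EFinP; apply: measurable_funTS; exact: measurable_powR.
under eq_integral do rewrite /= ger0_norm ?powR_ge0//.
by rewrite integral_powR_itvoc// ltry.
Qed.

Lemma integrable_horner_powR p a : -1 < a ->
  mu.-integrable `]0, 1] (EFin \o (fun t => p.[t] * powR t a)).
Proof.
elim/poly_ind: p a => [|p c IH] a a1.
  apply: (eq_integrable _ (cst 0%E)) => //; last exact: integrable0.
  by move=> t _; rewrite /= horner0 mul0r.
have a2 : -1 < a + 1 by lra.
have : mu.-integrable `]0, 1] ((fun t : R => (p.[t] * powR t (a + 1))%:E) \+
    (fun t : R => c%:E * (powR t a)%:E))%E.
  apply: integrableD => //; first exact: IH.
  by apply: integrableZl => //; exact: integrable_powR.
apply: eq_integrable => // t; rewrite inE/= in_itv/= => /andP[t0 t1].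
rewrite -EFinM -EFinD !hornerE powRD; last by rewrite (gt_eqF t0) implybT.
by rewrite powRr1 ?ltW// mulrDl; congr (_ + _)%:E; ring.
Qed.

Lemma Rintegral_itvcc_horner_powR (f : R -> R) p a : -1 < a ->
  (forall t, 0 < t -> f t = p.[t] * powR t a) ->
  \int[mu]_(t in `[0, 1]) f t = \int[mu]_(t in `]0, 1]) (p.[t] * powR t a).
Proof.
move=> a1 fE; have fE_itv : {in `]0, 1]%classic, f =1 (fun t => p.[t] * powR t a)}.
  by move=> t; rewrite inE/= in_itv/= => /andP[t0 _]; exact: fE.
rewrite -Rintegral_itv_obnd_cbnd; first exact: eq_Rintegral.
have := integrable_horner_powR p a1; apply: eq_integrable => // t t01.
by rewrite /= fE_itv.
Qed.

Lemma Rintegral_hornerM_powR p q a : -1 < a ->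
  \int[mu]_(t in `]0, 1]) (p.[t] * q.[t] * powR t a) =
  \sum_(j < size q) q`_j * \int[mu]_(t in `]0, 1]) (p.[t] * powR t (a + j%:R)).
Proof.
suff horner_sum (s : seq R) b : -1 < b ->
    \int[mu]_(t in `]0, 1]) (p.[t] * (Poly s).[t] * powR t b) =
    \sum_(j < size s) s`_j * \int[mu]_(t in `]0, 1]) (p.[t] * powR t (b + j%:R)).
  by move=> a1; rewrite -horner_sum// polyseqK.
elim: s b => [|c s IH] b b1.
  by rewrite big_ord0; apply: Rintegral0_eq => t _; rewrite horner0 mulr0 mul0r.
have b2 : -1 < b + 1 by lra.
transitivity (\int[mu]_(t in `]0, 1])
    ((p * Poly s).[t] * powR t (b + 1) + c * (p.[t] * powR t b))).
  apply: eq_Rintegral => t; rewrite inE/= in_itv/= => /andP[t0 t1].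
  rewrite horner_cons hornerM powRD; last by rewrite (gt_eqF t0) implybT.
  by rewrite powRr1 ?ltW//; ring.
rewrite RintegralD//; last 2 first.
- exact: integrable_horner_powR.
- exact: (integrableZl _ c (integrable_horner_powR p b1)).
rewrite RintegralZl//; last exact: integrable_horner_powR.
rewrite big_ord_recl/= addr0 addrC; congr (_ + _).
transitivity (\int[mu]_(t in `]0, 1]) (p.[t] * (Poly s).[t] * powR t (b + 1))).
  by apply: eq_Rintegral => t _; rewrite hornerM.
rewrite (IH _ b2); apply: eq_bigr => j _.
by have -> : b + 1 + j%:R = b + (lift ord0 j)%:R by rewrite -addrA nat1r.
Qed.

Lemma Rintegral_horner_powR p a : -1 < a ->
  \int[mu]_(t in `]0, 1]) (p.[t] * powR t a) = \sum_(i < size p) p`_i / (a + i%:R + 1).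
Proof.
move=> a1; transitivity (\int[mu]_(t in `]0, 1]) ((1 : {poly R}).[t] * p.[t] * powR t a)).
  by apply: eq_Rintegral => t _; rewrite hornerC mul1r.
rewrite Rintegral_hornerM_powR//; apply: eq_bigr => i _; congr (_ * _).
have ai1 : -1 < a + i%:R by rewrite (lt_le_trans a1)// lerDl.
transitivity (\int[mu]_(t in `]0, 1]) powR t (a + i%:R)).
  by apply: eq_Rintegral => t _; rewrite hornerC mul1r.
by rewrite /Rintegral integral_powR_itvoc.
Qed.

End power_integral.

Section jacobi.
Context {R : realType}.
Local Notation mu := (@lebesgue_measure R).
Implicit Types (a al t u : R) (p q : {poly R}) (n k l j : nat).

Lemma finite_difference_eq0 (A : comNzRingType) n (p : {poly A}) : (size p <= n)%N ->
  \sum_(k < n.+1) (-1) ^+ k * 'C(n, k)%:R * p.[k%:R] = 0.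
Proof.
elim: n p => [|n IH] p.
  by rewrite leqn0 size_poly_eq0 => /eqP ->; rewrite big1// => k _; rewrite horner0 mulr0.
elim/poly_ind: p => [_|q c _ sp]; first by rewrite big1// => k _; rewrite horner0 mulr0.
have sq : (size q <= n)%N.
  by move: sp; rewrite size_MXaddC; case: ifP => [/andP[/eqP -> _]|//]; rewrite size_poly0.
have sum_sign : \sum_(k < n.+2) (-1) ^+ k * 'C(n.+1, k)%:R = 0 :> A.
  transitivity ((1 - 1 : A) ^+ n.+1); last by rewrite subrr expr0n.
  by rewrite exprDn; apply: eq_bigr => k _; rewrite expr1n mul1r mulr_natr.
transitivity (\sum_(k < n.+2) (-1) ^+ k * 'C(n.+1, k)%:R * (q.[k%:R] * k%:R)
   + c * \sum_(k < n.+2) (-1) ^+ k * 'C(n.+1, k)%:R).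
  rewrite mulr_sumr -big_split/=; apply: eq_bigr => k _.
  by rewrite hornerD hornerM hornerX hornerC; ring.
rewrite sum_sign mulr0 addr0 big_ord_recl/= !mulr0 add0r.
have sqX : (size (q \Po ('X + 1%:P)) <= n)%N.
  have [->|q0] := eqVneq q 0; first by rewrite comp_poly0 size_poly0.
  apply: leq_trans (size_comp_poly_leq _ _) _.
  by rewrite size_XaddC muln1 prednK ?size_poly_gt0.
transitivity (- n.+1%:R *
    \sum_(k < n.+1) (-1) ^+ k * 'C(n, k)%:R * (q \Po ('X + 1%:P)).[k%:R]); last first.
  by rewrite IH// mulr0.
rewrite mulr_sumr; apply: eq_bigr => k _.
rewrite horner_comp hornerD hornerX hornerC /bump/= add1n natr1 exprS.
have := congr1 (fun i : nat => i%:R : A) (mul_bin_diag n.+1 k).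
rewrite /= !natrM => bin.
transitivity (- ((-1) ^+ k * (k.+1%:R * 'C(n.+1, k.+1)%:R) * q.[k.+1%:R])); first by ring.
by rewrite -bin; ring.
Qed.

Lemma pochD a k l : poch a (k + l) = poch a k * poch (a + k%:R) l.
Proof.
rewrite /poch big_split_ord/=; congr (_ * _); apply: eq_bigr => i _.
by rewrite natrD addrA.
Qed.

Lemma pochN n k : (k <= n)%N -> poch (- n%:R : R) k = (-1) ^+ k * ('C(n, k) * k`!)%:R.
Proof.
rewrite bin_ffact; elim: k => [|k IH] kn; first by rewrite /poch big_ord0 mul1r.
rewrite -addn1 pochD (IH (ltnW kn)) /poch big_ord1 addr0 addn1 ffactnSr natrM.
by rewrite (natrB _ (ltnW kn)) exprS; ring.
Qed.

(* [P_n^(al,0)] in the variable [t = (1 - u) / 2]; the coefficients use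
   [(al+k+1)_(n-k) (n+al+1)_k = (al+k+1)_n]. *)
Definition shifted_jacobi al n : {poly R} :=
  \poly_(k < n.+1) ((-1) ^+ k * 'C(n, k)%:R * poch (al + k%:R + 1) n / n`!%:R).

Lemma size_shifted_jacobi al n : (size (shifted_jacobi al n) <= n.+1)%N.
Proof. exact: size_poly. Qed.

Lemma jacobiP_shifted al n t : jacobiP al 0 n (1 - 2 * t) = (shifted_jacobi al n).[t].
Proof.
rewrite /shifted_jacobi horner_poly /jacobiP; apply: eq_bigr => k _.
have kn : (k <= n)%N by rewrite -ltnS.
have -> : (1 - (1 - 2 * t)) / 2 = t by field.
congr (_ * _); rewrite pochN// natrM.
have -> : poch (al + k%:R + 1) n = poch (al + k%:R + 1) (n - k) * poch (n%:R + al + 0 + 1) k.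
  transitivity (poch (al + k%:R + 1) (n - k + k)); first by rewrite subnK.
  by rewrite pochD; congr (_ * poch _ _); rewrite natrB//; ring.
by field; rewrite !pnatr_eq0 -!lt0n !fact_gt0.
Qed.

(* Dividing [(al+k+1)_n] by its factor [al+k+1+j] leaves a polynomial in [k] of
   degree [n-1], which the [n]-th finite difference kills. *)
Lemma shifted_jacobi_moment al n j : -1 < al -> (j < n)%N ->
  \sum_(k < n.+1) (shifted_jacobi al n)`_k / (al + j%:R + k%:R + 1) = 0.
Proof.
move=> al1 jn; pose jo := Ordinal jn.
pose q : {poly R} := \prod_(i < n | i != jo) ('X + (al + 1 + i%:R)%:P).
have sq : (size q <= n)%N.
  rewrite size_prod => [|i _]; last by rewrite -size_poly_eq0 size_XaddC.
  under eq_bigr do rewrite size_XaddC.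
  rewrite sum_nat_const cardC1 card_ord; lia.
transitivity (n`!%:R^-1 * \sum_(k < n.+1) (-1) ^+ k * 'C(n, k)%:R * q.[k%:R]); last first.
  by rewrite finite_difference_eq0// mulr0.
rewrite mulr_sumr; apply: eq_bigr => k _; rewrite coef_poly ltn_ord.
have ajk0 : al + j%:R + k%:R + 1 != 0.
  by rewrite gt_eqF//; have := ler0n R k; have := ler0n R j; lra.
have -> : poch (al + k%:R + 1) n = (al + j%:R + k%:R + 1) * q.[k%:R].
  rewrite /poch (bigD1 jo)//= /q horner_prod; congr (_ * _); first by ring.
  by apply: eq_bigr => i _; rewrite hornerD hornerX hornerC; ring.
have : n`!%:R != 0 :> R by rewrite pnatr_eq0 -lt0n fact_gt0.
move: ajk0 (n`!%:R : R); move: (al + _ + _ + _) => A A0 N N0.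
by field; rewrite ?A0 ?N0.
Qed.

Lemma shifted_jacobi_orth al n q : -1 < al -> (size q <= n)%N ->
  \int[mu]_(t in `]0, 1]) ((shifted_jacobi al n).[t] * q.[t] * powR t al) = 0.
Proof.
move=> al1 sq; rewrite Rintegral_hornerM_powR// big1// => j _.
have alj : -1 < al + j%:R by rewrite (lt_le_trans al1)// lerDl.
rewrite Rintegral_horner_powR//.
rewrite (big_ord_widen n.+1 (fun i => (shifted_jacobi al n)`_i / (al + j%:R + i%:R + 1)))
  ?size_shifted_jacobi//.
rewrite [X in _ * X](_ : _ = 0) ?mulr0//.
rewrite -[RHS](shifted_jacobi_moment al1 (leq_trans (ltn_ord j) sq)).
rewrite [RHS](bigID (fun i : 'I_n.+1 => (i < size (shifted_jacobi al n))%N))/=.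
rewrite [X in _ = _ + X]big1 ?addr0// => i; rewrite -leqNgt => hi.
by rewrite nth_default// mul0r.
Qed.

Definition jacobiPhat_poly al n : {poly R} :=
  jacA al 0 n *: (shifted_jacobi al n \Po (2^-1 *: (1 - 'X))).

Lemma jacobiPhat_polyE al n u : jacobiPhat al 0 n u = (jacobiPhat_poly al n).[u].
Proof.
rewrite hornerZ horner_comp; congr (_ * _).
have -> : (2^-1 *: (1 - 'X)).[u] = (1 - u) / 2 by rewrite !hornerE mulrC.
by rewrite -jacobiP_shifted; congr jacobiP; field.
Qed.

Lemma jacobiPhat_orth al i j : -1 < al -> i != j ->
  \int[mu]_(t in `]0, 1])
    (jacobiPhat al 0 i (1 - 2 * t) * jacobiPhat al 0 j (1 - 2 * t) * powR t al) = 0.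
Proof.
move=> al1; wlog lt_ji : i j / (j < i)%N => [wlog_lt ij|_].
  have [lt_ji|lt_ij|eq_ji] := ltngtP j i.
  - exact: wlog_lt.
  - rewrite -[RHS](wlog_lt j i lt_ij); last by rewrite eq_sym.
    by apply: eq_Rintegral => t _; congr (_ * _); rewrite mulrC.
  - by rewrite eq_ji eqxx in ij.
pose q := (jacA al 0 i * jacA al 0 j) *: shifted_jacobi al j.
rewrite -[RHS](@shifted_jacobi_orth al i q)//.
  by apply: eq_Rintegral => t _; rewrite /jacobiPhat !jacobiP_shifted hornerZ; ring.
by apply: leq_trans (size_scale_leq _ _) _; exact: leq_trans (size_shifted_jacobi _ _) lt_ji.
Qed.

Lemma jac_hhat_shifted al i : -1 < al ->
  jac_hhat al 0 i = powR 2 (al + 1) *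
    \int[mu]_(t in `]0, 1]) (jacobiPhat al 0 i (1 - 2 * t) ^+ 2 * powR t al).
Proof.
move=> al1; pose q := (jacA al 0 i *: shifted_jacobi al i) ^+ 2.
have qE t : jacobiPhat al 0 i (1 - 2 * t) ^+ 2 = q.[t].
  by rewrite /jacobiPhat jacobiP_shifted horner_exp hornerZ.
under [in RHS]eq_Rintegral do rewrite qE.
have int_q := integrable_horner_powR q al1.
have mf : measurable_fun (`[-1, 1]%classic : set R) (fun u : R =>
    jacobiPhat al 0 i u ^+ 2 * powR (1 - u) al * powR (1 + u) 0).
  apply: measurable_funTS; apply: measurable_funM; first apply: measurable_funM.
  - rewrite (_ : jacobiPhat al 0 i = horner (jacobiPhat_poly al i)).
      by apply: measurable_funX; exact: measurable_horner.
    by apply/funext => u; rewrite jacobiPhat_polyE.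
  - by apply: (measurableT_comp (measurable_powR al)); exact: measurable_funB.
  - by apply: (measurableT_comp (measurable_powR 0)); exact: measurable_funD.
have n20 : (-2 : R) != 0 by rewrite oppr_eq0 pnatr_eq0.
have mI : measurable (`[-1, 1]%classic : set R) by [].
rewrite /jac_hhat (Rintegral_affine 1 n20 mI mf).
rewrite [`|_|](_ : _ = 2); last by rewrite normrN ger0_norm.
have -> : (fun t : R => -2 * t + 1) @^-1` `[-1, 1] = `[0, 1]%classic.
  by apply/seteqP; split => t /=; rewrite !in_itv/= => /andP[h1 h2]; apply/andP; split; lra.
rewrite (Rintegral_itvcc_horner_powR (p := powR 2 al *: q) al1) => [|t t0]; last first.
  have -> : -2 * t + 1 = 1 - 2 * t by ring.
  have -> : 1 - (1 - 2 * t) = 2 * t by ring.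
  by rewrite powRr0 mulr1 powRM// ?ltW// qE hornerZ; ring.
under eq_Rintegral do rewrite hornerZ -mulrA.
rewrite RintegralZl// mulrA; congr (_ * _).
by rewrite powRD ?powRr1 1?mulrC// pnatr_eq0 implybT.
Qed.

End jacobi.

Section sobolev_jacobi.
Context {R : realType}.
Implicit Types (a b al u : R) (p q : {poly R}) (n s k i : nat).

(* The constant coefficient of [P] is [q`_0 / 0 = 0]. *)
Definition poly_primitive a q : {poly R} :=
  let P : {poly R} := \poly_(i < (size q).+1) (q`_i.-1 / i%:R) in P - P.[a]%:P.

Lemma deriv_poly_primitive a q : (poly_primitive a q)^`() = q.
Proof.
rewrite derivB derivC subr0; apply/polyP => i.
rewrite coef_deriv coef_poly ltnS; case: ltnP => iq; last by rewrite mul0rn nth_default.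
by rewrite -[LHS]mulr_natr divfK// pnatr_eq0.
Qed.

Lemma poly_primitive_eq0 a q : (poly_primitive a q).[a] = 0.
Proof. by rewrite !hornerE subrr. Qed.

Lemma derivn_iter_primitive a q s : (iter s (poly_primitive a) q)^`(s) = q.
Proof. by elim: s => [|s IH]; rewrite ?derivn0// iterS derivSn deriv_poly_primitive. Qed.

Lemma derivn_iter_primitive_eq0 a q s k : (k < s)%N ->
  (iter s (poly_primitive a) q)^`(k).[a] = 0.
Proof.
elim: s k => [//|s IH] [|k] ks; first by rewrite derivn0 iterS poly_primitive_eq0.
by rewrite iterS derivSn deriv_poly_primitive IH.
Qed.

Lemma oint_deriv_horner a b p : oint a b (fun w => p^`().[w]) = p.[b] - p.[a].
Proof.
rewrite /oint; case: (leP a b) => ab; first by rewrite Rintegral_deriv_horner.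
by rewrite Rintegral_deriv_horner ?ltW// opprB.
Qed.

Lemma inv_factMn n : (n.+1)`!%:R^-1 *+ n.+1 = n`!%:R^-1 :> R.
Proof. by rewrite -[LHS]mulr_natr factS natrM invfM mulrAC mulVf ?mul1r// pnatr_eq0. Qed.

(* The Taylor polynomial of [p] of order [s] at ['X], evaluated at [u]: its
   derivative telescopes to the integrand of the remainder. *)
Definition taylor_center p u s : {poly R} :=
  \sum_(i < s) (i`!%:R)^-1 *: ((u%:P - 'X) ^+ i * p^`(i)).

Lemma horner_taylor_center p u s a :
  (taylor_center p u s).[a] = \sum_(i < s) (u - a) ^+ i / i`!%:R * p^`(i).[a].
Proof.
rewrite horner_sum; apply: eq_bigr => i _.
by rewrite hornerZ hornerM horner_exp hornerD hornerN hornerX hornerC mulrA [_^-1 * _]mulrC.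
Qed.

Lemma deriv_taylor_center p u s :
  (taylor_center p u s.+1)^`() = (s`!%:R)^-1 *: ((u%:P - 'X) ^+ s * p^`(s.+1)).
Proof.
elim: s => [|s IH].
  by rewrite /taylor_center big_ord1 fact0 invr1 !scale1r !expr0 !mul1r derivn0 derivn1.
rewrite /taylor_center big_ord_recr/= -/(taylor_center p u s.+1) derivD IH derivZ derivM.
rewrite deriv_exp derivB derivC derivX sub0r /= mulN1r -derivnS scalerDr addrA.
rewrite -[RHS]add0r; congr (_ + _).
by rewrite mulrnAl mulNr -scalerMnr scalerMnl inv_factMn scalerN subrr.
Qed.

Lemma taylor_integral_remainder p a u s : p.[u] =
  \sum_(i < s.+1) (u - a) ^+ i / i`!%:R * p^`(i).[a] +
  oint a u (fun w => (u - w) ^+ s / s`!%:R * p^`(s.+1).[w]).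
Proof.
transitivity ((taylor_center p u s.+1).[u]).
  rewrite horner_taylor_center big_ord_recl/= fact0 divr1 mul1r big1 ?addr0// => i _.
  by rewrite subrr /bump/= add1n exprS !mul0r.
rewrite -horner_taylor_center -[LHS](subrK (taylor_center p u s.+1).[a]) addrC.
congr (_ + _).
rewrite -oint_deriv_horner; congr oint; apply/funext => w.
rewrite deriv_taylor_center hornerZ hornerM horner_exp hornerD hornerN hornerX hornerC.
by rewrite mulrA [_^-1 * _]mulrC.
Qed.

Lemma derivn_taylor_basis n k :
  ((n`!%:R)^-1 *: ('X + 1) ^+ n : {poly R})^`(k).[-1] = (n == k)%:R.
Proof.
have dX1 : ('X + 1 : {poly R})^`() = 1 by rewrite derivD derivX -polyC1 derivC addr0.
elim: k n => [|k IH] [|n].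
- by rewrite derivn0 expr0 fact0 invr1 scale1r hornerC.
- by rewrite derivn0 !hornerE addNr exprS mul0r mulr0.
- by rewrite expr0 derivSn derivZ -polyC1 derivC scaler0 derivn_poly0 ?size_poly0// horner0.
rewrite derivSn derivZ deriv_exp dX1 mul1r /= eqSS -IH; congr (_^`(k).[_]).
by rewrite -scalerMnr scalerMnl inv_factMn.
Qed.

Definition jacJ_poly al s n : {poly R} :=
  if (n < s)%N then (n`!%:R)^-1 *: ('X + 1) ^+ n
  else iter s (poly_primitive (-1)) (jacobiPhat_poly (al + s%:R) (n - s)).

Lemma jacJE al s n u : (0 < s)%N -> jacJ al s n u = (jacJ_poly al s n).[u].
Proof.
case: s => // s _; rewrite /jacJ /jacJ_poly; case: ltnP => ns; first by rewrite !hornerE mulrC.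
rewrite (taylor_integral_remainder _ (-1) u s) big1 ?add0r => [|i _].
  rewrite derivn_iter_primitive; congr oint; apply/funext => w.
  by rewrite jacobiPhat_polyE.
by rewrite derivn_iter_primitive_eq0// mulr0.
Qed.

Lemma derivn_jacJ_poly al s n : (jacJ_poly al s n)^`(s) =
  if (n < s)%N then 0 else jacobiPhat_poly (al + s%:R) (n - s).
Proof.
rewrite /jacJ_poly; case: ltnP => ns; last exact: derivn_iter_primitive.
rewrite derivnZ derivn_poly0 ?scaler0//.
by apply: leq_trans (size_poly_exp_leq _ _) _; rewrite -polyC1 size_XaddC mul1n.
Qed.

Lemma horner_derivn_jacJ_poly al s n k : (k < s)%N ->
  (jacJ_poly al s n)^`(k).[-1] = (n == k)%:R.
Proof.
move=> ks; rewrite /jacJ_poly; case: ltnP => ns; first exact: derivn_taylor_basis.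
by rewrite derivn_iter_primitive_eq0// gtn_eqF// (leq_trans ks).
Qed.

End sobolev_jacobi.

Section radial_inner_product.
Context {R : realType}.
Local Notation mu := (@lebesgue_measure R).
Implicit Types (al : R) (lam : nat -> R) (q : {poly R}) (s i j k : nat).

(* The powers of [2] come from [d/dt = -2 d/du] for [u = 1 - 2 t]. *)
Definition radial_ip al s lam q q' : R :=
  2 ^+ (2 * s) * \int[mu]_(t in `]0, 1])
    (q^`(s).[1 - 2 * t] * q'^`(s).[1 - 2 * t] * powR t al)
  + \sum_(k < s) 2 ^+ (2 * k) * lam k * (q^`(k).[-1] * q'^`(k).[-1]).

Definition radial_sqnorm al s lam i : R :=
  if (i < s)%N then 2 ^+ (2 * i) * lam i
  else powR 2 (2 * s%:R - al - 1) * jac_hhat al 0 (i - s).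

Lemma Rintegral_derivn_jacJ_poly al s i j : -1 < al + s%:R ->
  \int[mu]_(t in `]0, 1]) ((jacJ_poly al s i)^`(s).[1 - 2 * t] *
    (jacJ_poly al s j)^`(s).[1 - 2 * t] * powR t (al + s%:R)) =
  if (i < s)%N || (i != j) then 0 else
  powR 2 (- (al + s%:R) - 1) * jac_hhat (al + s%:R) 0 (i - s).
Proof.
move=> al1; rewrite !derivn_jacJ_poly.
case: (ltnP i s) => [_|le_si] /=.
  by apply: Rintegral0_eq => t _; rewrite horner0 !mul0r.
case: (ltnP j s) => [lt_js|le_sj].
  rewrite gtn_eqF ?(leq_trans lt_js)//=.
  by apply: Rintegral0_eq => t _; rewrite horner0 mulr0 mul0r.
under eq_Rintegral do rewrite -!jacobiPhat_polyE.
case: eqVneq => [<-|ij] /=; last first.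
  by rewrite jacobiPhat_orth// -(eqn_add2r s) !subnK.
under eq_Rintegral do rewrite -expr2.
rewrite jac_hhat_shifted// mulrA -powRD ?pnatr_eq0 ?implybT//.
by rewrite -opprD addNr powRr0 mul1r.
Qed.

Lemma sum_horner_derivn_jacJ_poly al s (c : nat -> R) i j :
  \sum_(k < s) c k * ((jacJ_poly al s i)^`(k).[-1] * (jacJ_poly al s j)^`(k).[-1]) =
  if (i == j) && (i < s)%N then c i else 0.
Proof.
under eq_bigr do rewrite !horner_derivn_jacJ_poly// -natrM mulnb.
case: ifPn => [/andP[/eqP <- lt_is]|ij].
  rewrite (bigD1 (Ordinal lt_is))//= eqxx mulr1 big1 ?addr0// => k.
  by rewrite -val_eqE/= eq_sym => /negbTE ->; rewrite mulr0.
apply: big1 => k _; case: eqP => [ik|]; last by rewrite mulr0.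
case: eqP => [jk|]; last by rewrite mulr0.
by move: ij; rewrite ik jk eqxx ltn_ord.
Qed.

Lemma radial_ip_jacJ_poly al s lam i j : -1 < al + s%:R ->
  radial_ip (al + s%:R) s lam (jacJ_poly al s i) (jacJ_poly al s j) =
  (i == j)%:R * radial_sqnorm (al + s%:R) s lam i.
Proof.
move=> al1; rewrite /radial_ip Rintegral_derivn_jacJ_poly//.
rewrite (sum_horner_derivn_jacJ_poly al s (fun k => 2 ^+ (2 * k) * lam k)) /radial_sqnorm.
case: eqVneq => [_|_]; last by rewrite orbT mulr0 add0r mul0r.
case: ltnP => _ /=; rewrite mul1r; first by rewrite mulr0 add0r.
rewrite addr0 mulrA -powR_mulrn// -powRD ?pnatr_eq0 ?implybT//.
by congr (powR _ _ * _); rewrite natrM; ring.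
Qed.

End radial_inner_product.

Section sobolev_inner_product.
Context {R : realType} {d : nat}.
Local Notation mu := (@lebesgue_measure R).
Implicit Types (beta : R) (lam : nat -> R) (q : {poly R}) (p : mpoly d R).
Implicit Types (x : 'rV[R]_d) (t : R) (Y : nat -> nat -> mpoly d R).

Definition separated q p x t : R := q.[1 - 2 * t] * peval p x.

Lemma derive1n_horner q k : derive1n k (horner q) = horner q^`(k).
Proof. by elim: k => [//|k IH]; rewrite derive1nS IH derivnS derivE. Qed.

Lemma derivn_comp_affine (A : comNzRingType) (q : {poly A}) (a b : A) k :
  (q \Po (a *: 'X + b%:P))^`(k) = a ^+ k *: (q^`(k) \Po (a *: 'X + b%:P)).
Proof.
elim: k => [|k IH]; first by rewrite scale1r !derivn0.
rewrite !derivnS IH derivZ deriv_comp derivD derivZ derivX derivC addr0.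
by rewrite -scalerAr mulr1 scalerA exprSr.
Qed.

Lemma horner_comp_affine q t : (q \Po (-2 *: 'X + 1%:P)).[t] = q.[1 - 2 * t].
Proof. by rewrite horner_comp !hornerE mulNr addrC. Qed.

Lemma dtn_separated q p k x t :
  dtn k (separated q p) x t = (-2) ^+ k * q^`(k).[1 - 2 * t] * peval p x.
Proof.
rewrite /dtn (_ : separated q p x = horner (peval p x *: (q \Po (-2 *: 'X + 1%:P)))).
  rewrite derive1n_horner derivnZ hornerZ derivn_comp_affine hornerZ.
  by rewrite horner_comp_affine mulrC.
by apply/funext => u; rewrite hornerZ horner_comp_affine mulrC.
Qed.

Lemma sobSE Y beta s n m l : (0 < s)%N -> sobS Y beta s n m l =
  separated (jacJ_poly (2 * m%:R + beta + d%:R - 1) s (n - m)) (Y m l).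
Proof. by move=> s0; apply/funext => x; apply/funext => t; rewrite /sobS jacJE. Qed.

Section separated_product.
Variables (beta : R) (s : nat) (lam : nat -> R).
Variables (q q' : {poly R}) (m m' : nat) (p p' : mpoly d R).
Hypotheses (d_gt0 : (0 < d)%N) (beta_gt : - d%:R - s%:R < beta).
Hypotheses (hp : p \is m.-homog) (hp' : p' \is m'.-homog).

Let sphere_pp' : R := sphere_int (fun xi => peval p xi * peval p' xi).

Let exponent : R := (m + m')%:R + beta + d%:R - 1 + s%:R.

Lemma sphere_int_dtn_separated k t c :
  sphere_int (fun xi => dtn k (separated q p) (t *: xi) t *
    dtn k (separated q' p') (t *: xi) t * c) =
  2 ^+ (2 * k) * t ^+ (m + m') * (q^`(k).[1 - 2 * t] * q'^`(k).[1 - 2 * t]) * c * sphere_pp'.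
Proof.
rewrite /sphere_pp' mulr_peval -sphere_intZ; congr sphere_int; apply/funext => xi.
rewrite pevalM !dtn_separated (peval_homogZ _ _ hp) (peval_homogZ _ _ hp').
by rewrite exprM -[2 ^+ 2]sqrrN exprD -exprM mulnC exprM expr2; ring.
Qed.

Lemma cone_int_dtn_separated :
  cone_int (fun x t => dtn s (separated q p) x t * dtn s (separated q' p') x t *
    powR t (beta + s%:R)) =
  sphere_pp' * (2 ^+ (2 * s) * \int[mu]_(t in `]0, 1])
    (q^`(s).[1 - 2 * t] * q'^`(s).[1 - 2 * t] * powR t exponent)).
Proof.
have exponent_gt : -1 < exponent.
  by have := beta_gt; have := ler0n R (m + m'); rewrite /exponent; lra.
pose r : {poly R} := (q^`(s) \Po (-2 *: 'X + 1%:P)) * (q'^`(s) \Po (-2 *: 'X + 1%:P)).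
have rE t : r.[t] = q^`(s).[1 - 2 * t] * q'^`(s).[1 - 2 * t].
  by rewrite hornerM !horner_comp_affine.
under [in RHS]eq_Rintegral do rewrite -rE.
rewrite mulrA -RintegralZl//; last exact: integrable_horner_powR.
rewrite /cone_int.
rewrite (Rintegral_itvcc_horner_powR (p := (sphere_pp' * 2 ^+ (2 * s)) *: r) exponent_gt).
  by apply: eq_Rintegral => t _; rewrite hornerZ mulrA.
move=> t t0; rewrite sphere_int_dtn_separated hornerZ rE.
have -> : powR t exponent = t ^+ d.-1 * t ^+ (m + m') * powR t (beta + s%:R).
  have -> : exponent = d.-1%:R + (m + m')%:R + (beta + s%:R).
    by rewrite /exponent -[in d%:R](prednK d_gt0) -natr1; ring.
  by rewrite !powRD ?(gt_eqF t0) ?implybT// !powR_mulrn// ltW.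
by ring.
Qed.

Lemma sob_ip_separated :
  sob_ip beta s lam (separated q p) (separated q' p') =
  (omega R d)^-1 * sphere_pp' * radial_ip exponent s lam q q'.
Proof.
rewrite /sob_ip cone_int_dtn_separated /radial_ip mulrDr mulr_sumr -mulrA; congr (_ + _).
apply: eq_bigr => k _.
have -> : sphere_int (fun xi => dtn k (separated q p) xi 1 * dtn k (separated q' p') xi 1) =
    2 ^+ (2 * k) * (q^`(k).[-1] * q'^`(k).[-1]) * sphere_pp'.
  have := sphere_int_dtn_separated k 1 1; rewrite expr1n !mulr1.
  have -> : 1 - 2 = -1 :> R by ring.
  by move=> <-; congr sphere_int; apply/funext => xi; rewrite scale1r mulr1.
by ring.
Qed.

End separated_product.

Lemma sob_ip_sobS beta s lam N Y n m l n' m' l' : (0 < d)%N -> (0 < s)%N ->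
  - d%:R - s%:R < beta -> sph_harm_ONB N Y ->
  (m <= n)%N -> (1 <= l <= N m)%N -> (m' <= n')%N -> (1 <= l' <= N m')%N ->
  sob_ip beta s lam (sobS Y beta s n m l) (sobS Y beta s n' m' l') =
  ((n, m, l) == (n', m', l'))%:R * sob_h d beta s lam m n.
Proof.
move=> d0 s0 beta_gt onb mn hl m'n' hl'.
have harm k i : (1 <= i <= N k)%N -> homog_harmonic k (Y k i) by exact: (onb k).1.
rewrite !sobSE// (sob_ip_separated lam _ _ d0 beta_gt (homog_harmonicP (harm _ _ hl)).1
  (homog_harmonicP (harm _ _ hl')).1) !xpair_eqE.
have [m_eq|mm'] := eqVneq m m'; last first.
  rewrite (sphere_int_harmonic_orth (harm _ _ hl) (harm _ _ hl') mm').
  by rewrite mulr0 mul0r andbF mul0r.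
subst m'; rewrite ((onb m).2.1 l l' hl hl') addnn -mul2n natrM.
rewrite radial_ip_jacJ_poly; last by have := ler0n R m; lra.
have -> : (n - m == n' - m)%N = (n == n') by rewrite -(eqn_add2r m) !subnK.
have -> : radial_sqnorm (2 * m%:R + beta + d%:R - 1 + s%:R) s lam (n - m) =
    sob_h d beta s lam m n.
  rewrite /radial_sqnorm /sob_h; case: (ltnP (n - m) s) => _; first by [].
  by congr (powR _ _ * jac_hhat _ _ _); ring.
by rewrite andbT mulrA -natrM mulnb andbC.
Qed.

End sobolev_inner_product.

Theorem mainTheorem2 (R : realType) (d s : nat) (beta : R) (lam : nat -> R)
    (N : nat -> nat) (Y : nat -> nat -> mpoly.mpoly d R) :
  (2 <= d)%N -> (1 <= s)%N -> - d%:R - s%:R < beta ->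
  (forall k, (k < s)%N -> 0 < lam k) ->
  sph_harm_ONB N Y ->
  (forall n m l n' m' l',
     (m <= n)%N -> (1 <= l <= N m)%N -> (m' <= n')%N -> (1 <= l' <= N m')%N ->
     (n, m, l) != (n', m', l') ->
     sob_ip beta s lam (sobS Y beta s n m l) (sobS Y beta s n' m' l') = 0) /\
  (forall n m l, (m <= n)%N -> (1 <= l <= N m)%N ->
     sob_ip beta s lam (sobS Y beta s n m l) (sobS Y beta s n m l)
     = sob_h d beta s lam m n).
Proof.
move=> d2 s1 beta_gt _ onb; have d0 : (0 < d)%N by exact: ltnW.
split=> [n m l n' m' l' mn hl mn' hl' /negbTE neq|n m l mn hl].
  by rewrite (sob_ip_sobS lam d0 s1 beta_gt onb)// neq mul0r.
by rewrite (sob_ip_sobS lam d0 s1 beta_gt onb)// eqxx mul1r.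
Qed.
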